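(* For every fixed integer $r$, the problem $r$-Sparse Bounded Integer Linear Program Feasibility parameterized by $n+d$ admits a polynomial kernelization producing an equivalent instance of size $\mathcal{O}(n^r\cdot d^r\cdot \log (nd))$.
   Context: A matrix is $r$-row-sparse if each of its rows has at most $r$ nonzero entries. The problem $r$-Sparse Bounded Integer Linear Program Feasibility($n$,$d$): given an $r$-row-sparse matrix $A\in\mathbb{Q}^{m\times n}$, a vector $b\in\mathbb{Q}^m$ and a positive integer $d$, with parameter $n+d$, decide whether there exists $x\in\{0,\ldots,d-1\}^n$ with $Ax\leq b$. A kernelization is a polynomial-time algorithm that, given an instance with parameter $k$, outputs an instance of the same problem which is a yes-instance iff the input is, and whose size (encoding length plus parameter) is bounded by a computable function $h(k)$; it is polynomial if $h$ is polynomially bounded. *)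

(* Defs.v *)
From HB Require Import structures.
From mathcomp Require Import all_boot all_order all_algebra.

Set Implicit Arguments.
Unset Strict Implicit.
Unset Printing Implicit Defensive.

Import Order.TTheory GRing.Theory Num.Theory.

Local Open Scope nat_scope.

(* Binary digits of |z| plus a sign bit; trunc_log 2 is the integer part of
   the base-2 logarithm, and trunc_log 2 0 = 0. *)
Definition bitlen (z : int) : nat := (trunc_log 2 `|z|%N).+2.

Definition enclen (w : seq int) : nat := \sum_(z <- w) bitlen z.

(** The computation model is a random access machine under the logarithmic cost
    criterion, with structured control flow.  It has finitely many registers
    per program, a random access memory of integers of unbounded size, and a
    write-only output tape. *)

Inductive binop : Type := Add | Sub | Mul | Div.

Inductive expr : Type :=
| Cst of int
| Reg of nat
| Mem of expr
| Bin of binop & expr & expr.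

Inductive com : Type :=
| Skip
| Assign of nat & expr
| Store of expr & expr
| Write of expr
| Seq of com & com
| If of expr & com & com
| While of expr & com.

Record state : Type := State {
  reg : nat -> int;
  mem : int -> int;
  out : seq int
}.

(* Div is Euclidean division, with quotient 0 for divisor 0. *)
Definition eval_op (o : binop) (a b : int) : int :=
  match o with
  | Add => (a + b)%R
  | Sub => (a - b)%R
  | Mul => (a * b)%R
  | Div => (a %/ b)%Z
  end.

Fixpoint eval (s : state) (e : expr) : int :=
  match e with
  | Cst z => z
  | Reg x => reg s x
  | Mem a => mem s (eval s a)
  | Bin o e1 e2 => eval_op o (eval s e1) (eval s e2)
  end.

(* Every value that occurs, addresses included, is charged its bit length. *)
Fixpoint ecost (s : state) (e : expr) : nat :=
  bitlen (eval s e) +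
  match e with
  | Cst _ | Reg _ => 0
  | Mem a => ecost s a
  | Bin _ e1 e2 => ecost s e1 + ecost s e2
  end.

Definition set_reg (s : state) (x : nat) (v : int) : state :=
  State [eta reg s with x |-> v] (mem s) (out s).

Definition set_mem (s : state) (a v : int) : state :=
  State (reg s) [eta mem s with a |-> v] (out s).

Definition emit (s : state) (v : int) : state :=
  State (reg s) (mem s) (rcons (out s) v).

(* exec c s t s' : started in s, the program c halts in s' after time t. *)
Inductive exec : com -> state -> nat -> state -> Prop :=
| ExecSkip s :
    exec Skip s 1 s
| ExecAssign s x e :
    exec (Assign x e) s (ecost s e).+1 (set_reg s x (eval s e))
| ExecStore s a e :
    exec (Store a e) s (ecost s a + ecost s e).+1
      (set_mem s (eval s a) (eval s e))
| ExecWrite s e :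
    exec (Write e) s (ecost s e).+1 (emit s (eval s e))
| ExecSeq c1 c2 s1 s2 s3 t1 t2 :
    exec c1 s1 t1 s2 -> exec c2 s2 t2 s3 ->
    exec (Seq c1 c2) s1 (t1 + t2) s3
| ExecIfTrue e c1 c2 s s' t :
    (0 < eval s e)%R -> exec c1 s t s' ->
    exec (If e c1 c2) s (ecost s e + t).+1 s'
| ExecIfFalse e c1 c2 s s' t :
    (eval s e <= 0)%R -> exec c2 s t s' ->
    exec (If e c1 c2) s (ecost s e + t).+1 s'
| ExecWhileTrue e c s1 s2 s3 t1 t2 :
    (0 < eval s1 e)%R -> exec c s1 t1 s2 -> exec (While e c) s2 t2 s3 ->
    exec (While e c) s1 (ecost s1 e + t1 + t2).+1 s3
| ExecWhileFalse e c s :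
    (eval s e <= 0)%R ->
    exec (While e c) s (ecost s e).+1 s.

(* The input word occupies the memory cells 0, 1, ..., size w - 1, and its
   length is in register 0; everything else is 0. *)
Definition init (w : seq int) : state :=
  State (fun x => if x is 0 then Posz (size w) else 0%R)
        (fun a => if a is Posz k then nth 0%R w k else 0%R)
        [::].

Definition computes_in (c : com) (w : seq int) (t : nat) (w' : seq int) : Prop :=
  exists2 s : state, exec c (init w) t s & out s = w'.

Definition poly_bounded (f : nat -> nat) : Prop :=
  exists c : nat, forall k : nat, f k <= c * k ^ c + c.

Record pproblem : Type := PProblem {
  pp_inst :> Type;
  pp_enc : pp_inst -> seq int;
  pp_param : pp_inst -> nat;
  pp_yes : pp_inst -> Prop
}.

Definition isize (P : pproblem) (I : P) : nat :=
  enclen (pp_enc I) + pp_param I.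

(* The running time is polynomial in encoding length plus parameter. *)
Definition poly_kernelization (P : pproblem) (c : com) (K : P -> P) : Prop :=
  [/\ exists T : nat -> nat, poly_bounded T /\
        forall I : P, exists2 t : nat, t <= T (isize I) &
          computes_in c (pp_enc I) t (pp_enc (K I)),
      forall I : P, pp_yes (K I) <-> pp_yes I
    & exists h : nat -> nat, poly_bounded h /\
        forall I : P, isize (K I) <= h (pp_param I)].

Definition row_sparse (r m n : nat) (A : 'M[rat]_(m, n)) : Prop :=
  forall i : 'I_m, #|[set j : 'I_n | A i j != 0%R]| <= r.

Record sbilp (r : nat) : Type := SBILP {
  nrows : nat;
  nvars : nat;
  dom : nat;
  lhs : 'M[rat]_(nrows, nvars);
  rhs : 'cV[rat]_nrows;
  dom_gt0 : 0 < dom;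
  lhs_sparse : row_sparse r lhs
}.

Definition sbilp_feasible (r : nat) (I : sbilp r) : Prop :=
  exists x : 'I_(nvars I) -> 'I_(dom I), forall i : 'I_(nrows I),
    ((lhs I *m \col_j (x j : nat)%:R) i ord0 <= rhs I i ord0)%R.

Definition enc_rat (q : rat) : seq int := [:: numq q; denq q].

(* A row is stored sparsely: the number of its nonzero entries, these entries
   with their column indices in increasing order, and the right-hand side.
   With a dense encoding a row would already take length n. *)
Definition enc_row (n : nat) (a : 'rV[rat]_n) (b : rat) : seq int :=
  let supp := [seq j <- enum 'I_n | a ord0 j != 0%R] in
  Posz (size supp) ::
    flatten [seq Posz (j : nat) :: enc_rat (a ord0 j) | j : 'I_n <- supp] ++ enc_rat b.

Definition enc_sbilp (r : nat) (I : sbilp r) : seq int :=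
  [:: Posz (nvars I); Posz (dom I); Posz (nrows I)] ++
    flatten [seq enc_row (row i (lhs I)) (rhs I i ord0) | i <- enum 'I_(nrows I)].

Definition sparse_bounded_ilp (r : nat) : pproblem :=
  @PProblem (sbilp r) (@enc_sbilp r) (fun I => nvars I + dom I)
            (@sbilp_feasible r).

(* Main.v *)
Require Import Defs.
From HB Require Import structures.
From mathcomp Require Import all_boot all_order all_algebra.
From mathcomp Require Import zify ring lra.

(** For a tuple J of r columns (a scope) and an assignment p of values in
    {0, ..., d-1} to these columns, only one constraint is needed: if p violates
    an input row supported in J, any inequality on J that cuts off p and is valid
    at every assignment of J satisfying all input rows supported in J.  This gives
    n^r * d^r output rows.  The coefficients of such an inequality can be chosen
    polynomial in d: if p violates the row u.x <= b, it is enough that a.(p - q) > 0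
    whenever u.(p - q) > 0, for the finitely many integer vectors p - q, and
    Fourier-Motzkin elimination replaces u by a small integer vector a with this
    property.  As r is fixed, such an a is found in polynomial time by trying all
    small coefficient vectors.

    The program never writes to memory and all loops over {0, ..., r-1} are unrolled
    into expressions, so that a uniform bound on the registers, on the input and on
    the number of iterations of each loop bounds the running time. *)

Set Implicit Arguments.
Unset Strict Implicit.
Unset Printing Implicit Defensive.

Import Order.TTheory GRing.Theory Num.Theory.

Local Open Scope nat_scope.

(** * Small integer functionals with prescribed positivity *)

(** This is the growth in one elimination step: combining two vectors with entries at most [D] gives
    entries at most [2 * (D * D)], and going back up to [k] coordinates costs a factor
    [2 * k * (D * D)]. *)
Fixpoint coef_bound (k D : nat) : nat :=
  if k is k'.+1 then 2 * k * (D * D) * coef_bound k' (2 * (D * D)) else 1.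

Lemma coef_bound_gt0 k D : 0 < D -> 0 < coef_bound k D.
Proof.
elim: k D => //= k IH D D0.
by rewrite !muln_gt0 D0 IH // !muln_gt0 D0.
Qed.

(** The recursive call squares [D], so the degree goes from [e] to [2 + 2 * e]. It is exponential in
    [k], which is harmless because [k] will be the constant [r]. *)
Lemma coef_bound_poly k : exists c e, forall D, coef_bound k D <= c * D ^ e.
Proof.
elim: k => [|k [c [e IH]]]; first by exists 1, 0 => D; rewrite expn0.
exists (2 * k.+1 * (c * 2 ^ e)), (2 + 2 * e) => D.
rewrite /= (leq_trans (leq_mul (leqnn _) (IH _))) //.
by rewrite expnMn expnD expnM -mulnn !mulnA; apply/eq_leq; ring.
Qed.

Lemma abs_dot_le k (a v : nat -> int) (B D : nat) :
  (forall i, i < k -> `|a i| <= B) -> (forall i, i < k -> `|v i| <= D) ->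
  `|(\sum_(i < k) a i * v i)%R| <= k * (B * D).
Proof.
elim: k => [|k IH] ha hv; first by rewrite big_ord0.
have tri (x y : int) : `|(x + y)%R| <= `|x| + `|y| by lia.
rewrite big_ord_recr /= mulSn addnC (leq_trans (tri _ _)) // leq_add //.
  by apply: IH => i ik; [apply: ha | apply: hv]; apply: ltnW.
by rewrite abszM leq_mul ?ha ?hv.
Qed.

(* Fourier-Motzkin elimination of the last coordinate t of u: the constraints
   w.u' + s t > 0 with s > 0 bound t from below, those with s < 0 from above;
   the positive combinations of a lower and an upper one are constraints in one
   dimension less, and t is replaced by the middle of the remaining interval. *)
Lemma small_positive_functional k (D : nat) (T : finType)
    (v : T -> nat -> int) (u : nat -> rat) :
  0 < D -> (forall x i, i < k -> `|v x i| <= D) ->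
  exists a : nat -> int, (forall i, i < k -> `|a i| <= coef_bound k D) /\
    forall x, (0 < \sum_(i < k) u i * (v x i)%:~R :> rat)%R ->
              (0 < \sum_(i < k) a i * v x i :> int)%R.
Proof.
elim: k D T v => [|k IH] D T v D0 hv.
  by exists (fun=> 0%R); split=> // x; rewrite big_ord0 ltxx.
pose s x := v x k.
(* The vectors in one dimension less, indexed by pairs: a vector with last coordinate 0 is kept, any
   other is combined with a second one so that the last coordinates cancel. *)
pose w (p : T * T) i : int :=
  if s p.1 == 0%R then v p.1 i else (- s p.2 * v p.1 i + s p.1 * v p.2 i)%R.
have hs x : `|s x| <= D by apply: hv.
have hw p i : i < k -> `|w p i| <= 2 * (D * D).
  move=> ik; have ik' : i < k.+1 by lia.
  have h1 := leq_mul (hs p.2) (hv p.1 i ik').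
  have h2 := leq_mul (hs p.1) (hv p.2 i ik').
  have h3 := hv p.1 i ik'.
  have h4 : D <= D * D by rewrite leq_pmulr.
  move: h1 h2; rewrite -!abszM => h1 h2.
  by rewrite /w; case: eqP => _; rewrite ?mulNr; lia.
have D20 : 0 < 2 * (D * D) by rewrite !muln_gt0 D0.
have [a' [ha' pos']] := IH _ _ w D20 hw.
set B := coef_bound k (2 * (D * D)) in ha'.
have B0 : 0 < B by apply: coef_bound_gt0.
pose dotu x : rat := (\sum_(i < k) u i * (v x i)%:~R)%R.
pose dota x : int := (\sum_(i < k) a' i * v x i)%R.
have hdota x : `|dota x| <= k * (B * D).
  by apply: abs_dot_le => // i ik; apply: hv; lia.
have wpos x y : (s x != 0)%R ->
    ((0 < - (s y)%:~R * dotu x + (s x)%:~R * dotu y)%R : bool) ->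
    (0 < - s y * dota x + s x * dota y)%R.
  move=> sx0 h.
  have wxy i : w (x, y) i = (- s y * v x i + s x * v y i)%R by rewrite /w (negPf sx0).
  have -> : (- s y * dota x + s x * dota y = \sum_(i < k) a' i * w (x, y) i)%R.
    rewrite /dota !mulr_sumr -big_split /=; apply: eq_bigr => i _.
    by rewrite wxy; ring.
  apply: pos'; apply: etrans h; congr (_ < _)%R.
  rewrite /dotu !mulr_sumr -big_split /=; apply: eq_bigr => i _.
  by rewrite wxy intrD !intrM intrN; ring.
have zpos x : s x = 0%R -> (0 < dotu x + u k * (s x)%:~R)%R -> (0 < dota x)%R.
  move=> sx0; rewrite sx0 mulr0 addr0 => h.
  by have := pos' (x, x); rewrite /w /= sx0 eqxx; apply.
(* The new last coefficient is the fraction [t / sg]; multiplying [a'] by [sg] keeps everything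
   integral. *)
suff [sg [t [sg0 hsg ht hpos]]] : exists sg t : int,
    [/\ (0 < sg)%R, `|sg| <= 2 * (D * D), `|t| <= 2 * k.+1 * (D * D) * B &
     forall x, (0 < dotu x + u k * (s x)%:~R)%R -> (0 < sg * dota x + t * s x)%R].
  exists (fun i => if i == k then t else (sg * a' i)%R); split.
    move=> i; rewrite ltnS leq_eqVlt /= => /orP[/eqP->|ik]; first by rewrite eqxx.
    rewrite ltn_eqF // abszM (leq_trans (leq_mul hsg (ha' _ ik))) //.
    rewrite -/B; apply: leq_mul => //.
    by rewrite -mulnA leq_mul2l /= leq_pmull.
  move=> x; rewrite !big_ord_recr /= eqxx => /hpos; apply: etrans.
  congr (_ < _ + _)%R; rewrite /dota mulr_sumr; apply: eq_bigr => i _.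
  by rewrite ltn_eqF ?ltn_ord // mulrA.
have key : 2 * D * (k * (B * D)) <= 2 * k.+1 * (D * D) * B /\
           k * (B * D) + D <= 2 * k.+1 * (D * D) * B.
  by split; nia.
case: key => key1 key2.
pose pos x := (0 < dotu x + u k * (s x)%:~R)%R.
pose lo x := pos x && (0 < s x)%R.
pose hi x := pos x && (s x < 0)%R.
(* The value of [t / sg] at which the form vanishes on [v x]: a strict lower bound for [lo x], a
   strict upper bound for [hi x]. *)
pose f x : rat := (- (dota x)%:~R / (s x)%:~R)%R.
have lohi x y : lo x -> hi y -> (0 < - s y * dota x + s x * dota y)%R.
  move=> /andP[px sx] /andP[py sy]; apply: wpos; first by rewrite gt_eqF.
  move: px py; rewrite /pos.
  have sx' : (0 < (s x)%:~R :> rat)%R by rewrite ltr0z.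
  have sy' : ((s y)%:~R < 0 :> rat)%R by rewrite ltrz0.
  move: (dotu x) (dotu y) (u k) => p q r px py.
  have := mulr_gt0 px (y := - (s y)%:~R)%R; rewrite oppr_gt0 => /(_ sy').
  have := mulr_gt0 py sx'.
  nra.
have hf x y : (s x != 0)%R -> (s y != 0)%R -> (0 < s x * s y)%R -> (f x <= f y)%R ->
    (dota y * s x <= dota x * s y)%R.
  move=> sx sy sxy; rewrite /f -subr_ge0.
  have -> : (- (dota y)%:~R / (s y)%:~R - - (dota x)%:~R / (s x)%:~R =
     (dota x * s y - dota y * s x)%:~R / (s x * s y)%:~R :> rat)%R.
    by rewrite intrB !intrM; field; rewrite !intr_eq0 sx sy.
  by rewrite pmulr_lge0 ?invr_gt0 ?ltr0z // ler0z subr_ge0.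
case: (pickP lo) => [x0 lo0|nlo]; case: (pickP hi) => [y0 hi0|nhi].
- case: (@arg_maxP _ _ _ x0 lo f lo0) => x lox maxx.
  case: (@arg_minP _ _ _ y0 hi f hi0) => y hiy miny.
  have := lohi _ _ lox hiy; case/andP: lox => px sx; case/andP: hiy => py sy sp.
  (* The midpoint of [f x] and [f y], with its denominator cleared. *)
  exists (2 * (s x * - s y))%R, (s y * dota x + s x * dota y)%R; split.
  + by rewrite !mulr_gt0 // oppr_gt0.
  + by rewrite !abszM abszN leq_mul2l /= leq_mul.
  + apply: leq_trans key1.
    have := leq_mul (hs y) (hdota x); have := leq_mul (hs x) (hdota y).
    by rewrite -!abszM; lia.
  + move=> z pz; case: (ltrgtP (s z) 0%R) => sz.
    * have hiz : hi z by rewrite /hi /pos pz.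
      have h := hf y z _ _ _ (miny z hiz).
      have {}h : (dota z * s y <= dota y * s z)%R by apply: h; nia.
      nia.
    * have loz : lo z by rewrite /lo /pos pz.
      have h := hf z x _ _ _ (maxx z loz).
      have {}h : (dota x * s z <= dota z * s x)%R by apply: h; nia.
      nia.
    * have h : (0 < dota z)%R by apply: zpos sz pz.
      nia.
- case: (@arg_maxP _ _ _ x0 lo f lo0) => x /andP[px sx] maxx.
  (* Without upper bounds, [t / sg] is [f x + 1] for the greatest lower bound; the next case takes
     [f y - 1] for the least upper bound. *)
  exists (s x), (s x - dota x)%R; split=> //.
  + by rewrite (leq_trans (hs _)) // -[D in D <= _]mul1n leq_mul //; nia.
  + by have := hs x; have := hdota x; lia.
  + move=> z pz; case: (ltrgtP (s z) 0%R) => sz.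
    * by have := nhi z; rewrite /hi /pos pz sz.
    * have loz : lo z by rewrite /lo /pos pz.
      have h := hf z x _ _ _ (maxx z loz).
      have {}h : (dota x * s z <= dota z * s x)%R by apply: h; nia.
      nia.
    * have h : (0 < dota z)%R by apply: zpos sz pz.
      nia.
- case: (@arg_minP _ _ _ y0 hi f hi0) => y /andP[py sy] miny.
  exists (- s y)%R, (s y + dota y)%R; split=> //.
  + by rewrite oppr_gt0.
  + by rewrite abszN (leq_trans (hs _)) // -[D in D <= _]mul1n leq_mul //; nia.
  + by have := hs y; have := hdota y; lia.
  + move=> z pz; case: (ltrgtP (s z) 0%R) => sz.
    * have hiz : hi z by rewrite /hi /pos pz.
      have h := hf y z _ _ _ (miny z hiz).
      have {}h : (dota z * s y <= dota y * s z)%R by apply: h; nia.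
      nia.
    * by have := nlo z; rewrite /lo /pos pz sz.
    * have h : (0 < dota z)%R by apply: zpos sz pz.
      nia.
- exists 1%R, 0%R; split=> //.
  move=> z pz; case: (ltrgtP (s z) 0%R) => sz.
  + by have := nhi z; rewrite /hi /pos pz sz.
  + by have := nlo z; rewrite /lo /pos pz sz.
  + by rewrite mul1r mul0r addr0; apply: zpos sz pz.
Qed.

(** * Digits in a base, and bounded search *)

Definition digit (b i v : nat) : nat := v %/ b ^ i %% b.

Lemma digit_lt b i v : 0 < b -> digit b i v < b.
Proof. exact: ltn_pmod. Qed.

Lemma digit_addM b k i v w : 0 < b -> i < k -> digit b i (v + w * b ^ k) = digit b i v.
Proof.
move=> b0 ik; rewrite /digit.
have -> : w * b ^ k = w * b ^ (k - i).-1 * b * b ^ i.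
  by rewrite -!mulnA -expnS -expnD; congr (_ * _ ^ _); lia.
by rewrite divnDMl ?expn_gt0 ?b0 // addnC modnMDl.
Qed.

Lemma digits_exist b k (f : nat -> nat) :
  0 < b -> (forall i, i < k -> f i < b) ->
  exists2 v, v < b ^ k & forall i, i < k -> digit b i v = f i.
Proof.
move=> b0; elim: k => [|k IH] hf; first by exists 0.
have [v vb hv] := IH (fun i ik => hf i (ltnW ik)).
exists (v + f k * b ^ k).
  by rewrite expnS; have := hf k (leqnn _); nia.
move=> i; rewrite ltnS leq_eqVlt => /orP[/eqP->|ik]; last first.
  by rewrite digit_addM // hv.
by rewrite /digit divnDMl ?expn_gt0 ?b0 // divn_small // add0n modn_small ?hf.
Qed.

(** The largest solution below [b] is what a loop finds that overwrites its result at every hit. The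
    default 0 is also the initial value of that loop. *)
Fixpoint last_sat (P : pred nat) (b : nat) : nat :=
  if b is b'.+1 then (if P b' then b' else last_sat P b') else 0.

Lemma has_iotaS (P : pred nat) b : has P (iota 0 b.+1) = has P (iota 0 b) || P b.
Proof. by rewrite -addn1 iotaD has_cat /= orbF. Qed.

Lemma all_iotaS (P : pred nat) b : all P (iota 0 b.+1) = all P (iota 0 b) && P b.
Proof. by rewrite -addn1 iotaD all_cat /= andbT. Qed.

Lemma last_satP P b : has P (iota 0 b) -> P (last_sat P b).
Proof.
elim: b => // b IH; rewrite has_iotaS [last_sat _ _]/=.
by case: ifP => // _; rewrite orbF.
Qed.

Lemma last_satN P b : ~~ has P (iota 0 b) -> last_sat P b = 0.
Proof.
elim: b => // b IH; rewrite has_iotaS negb_or [last_sat _ _]/=.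
by case/andP=> /IH -> /negPf ->.
Qed.

Lemma last_sat_lt P b : 0 < b -> last_sat P b < b.
Proof.
elim: b => //= b IH _; case: ifP => // _.
by case: b IH => // b IH; rewrite ltnS ltnW ?IH.
Qed.

(* The entries of a row as pairs (column, coefficient), and its right-hand side. *)
Definition srow : Type := (seq (nat * rat) * rat)%type.

Definition row_val (x : nat -> nat) (c : srow) : rat :=
  (\sum_(e <- c.1) e.2 * (x e.1)%:R)%R.

(** * The kernel of a system of sparse rows and its correctness *)

Section Kernel.

Variables (r n d : nat) (S : seq srow).

(* A scope is an r-tuple of columns, the base-n digits of J; a point is an r-tuple of
   values, the base-d digits of q, which gives column (digit n i J) the value
   (digit d i q); the largest i wins if a column is repeated. *)
Fixpoint point (k J q col : nat) : nat :=
  if k is k'.+1 then (if digit n k' J == col then digit d k' q else point k' J q col)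
  else 0.

Definition in_scope (J col : nat) : bool := has (fun i => digit n i J == col) (iota 0 r).

Definition excludes (J q : nat) (c : srow) : bool :=
  all (fun e => in_scope J e.1) c.1 && (c.2 < row_val (point r J q) c)%R.

Definition locally_feasible (J q : nat) : bool := all (fun c => ~~ excludes J q c) S.

Definition cbound : nat := coef_bound r d.
(** A vector of [r] coefficients between [- cbound] and [cbound] is coded by one natural number
    below [cbase ^ r]: its digits are the coefficients shifted by [cbound]. *)
Definition cbase : nat := 2 * cbound + 1.

Definition cdigit (a i : nat) : int := (Posz (digit cbase i a) - Posz cbound)%R.

(** A column repeated in [J] receives the sum of the coefficients at its positions, so that the
    value of the row is a sum over the positions of [J], see [sum_coef]. *)
Definition coef (J a j : nat) : int :=
  (\sum_(i < r) cdigit a i * Posz (digit n i J == j))%R.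

Definition dot (J a q : nat) : int :=
  (\sum_(i < r) cdigit a i * Posz (point r J q (digit n i J)))%R.

Definition separates (J p a : nat) : bool :=
  all (fun q => locally_feasible J q ==> (dot J a q < dot J a p)%R) (iota 0 (d ^ r)).

(** Output row [k] belongs to the scope [k %/ d ^ r]. The point is passed as [k] itself instead of
    [k %% d ^ r], since both have the same first [r] digits in base [d]. *)
Definition found (k : nat) : bool :=
  has (separates (k %/ d ^ r) k) (iota 0 (cbase ^ r)).

Definition best (k : nat) : nat := last_sat (separates (k %/ d ^ r) k) (cbase ^ r).

(* If the point is locally feasible then best k = 0, all coefficients are
   nonpositive and the row is satisfied by every nonnegative vector. *)
Definition krow (k j : nat) : int := coef (k %/ d ^ r) (best k) j.

(** By integrality, being less than [dot] at the point means being at most [dot - 1]. The factor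
    [found k] makes the right-hand side 0 if no code separates. *)
Definition krhs (k : nat) : int :=
  (Posz (found k) * (dot (k %/ d ^ r) (best k) k - 1))%R.

Definition knrows : nat := n ^ r * d ^ r.

Hypotheses (n0 : 0 < n) (d0 : 0 < d).

Lemma point_lt k J q col : point k J q col < d.
Proof. by elim: k => //= k IH; case: ifP => // _; apply: digit_lt. Qed.

Lemma cbase_gt0 : 0 < cbase.
Proof. by rewrite /cbase addn1. Qed.

(** Repeated columns cause no conflict, because all digits of [q] are values of the same function
    [x]. *)
Lemma point_agrees J q (x : nat -> nat) col :
  (forall i, i < r -> digit d i q = x (digit n i J)) -> in_scope J col ->
  point r J q col = x col.
Proof.
rewrite /in_scope => h /hasP[i]; rewrite mem_iota add0n => /= ir /eqP ic.
elim: r h ir => // k IH h ik; rewrite /=; case: eqP => [<-|ne]; first by rewrite h.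
apply: IH => [i' h'|]; first by apply: h; apply: leqW.
by move: ik; rewrite ltnS leq_eqVlt => /orP[/eqP e|//]; rewrite e in ic.
Qed.

Lemma in_scope_digit J i : i < r -> in_scope J (digit n i J).
Proof. by move=> ir; apply/hasP; exists i; rewrite ?mem_iota. Qed.

Lemma sum_coef J a (x : nat -> nat) :
  (\sum_(j < n) coef J a j * Posz (x j) =
   \sum_(i < r) cdigit a i * Posz (x (digit n i J)))%R.
Proof.
under eq_bigr => j _ do rewrite /coef mulr_suml.
rewrite exchange_big /=; apply: eq_bigr => i _.
rewrite (bigD1 (Ordinal (digit_lt i J n0))) //= eqxx mulr1 big1 ?addr0 // => j ne.
suff -> : (digit n i J == j) = false by rewrite mulr0 mul0r.
by apply/negbTE; apply: contra ne => /eqP e; apply/eqP/val_inj.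
Qed.

Lemma row_val_agrees J q (x : nat -> nat) c :
  (forall i, i < r -> digit d i q = x (digit n i J)) ->
  all (fun e => in_scope J e.1) c.1 -> row_val (point r J q) c = row_val x c.
Proof.
move=> h /allP hc; rewrite /row_val !big_seq; apply: eq_bigr => e ec.
by rewrite (point_agrees h) ?hc.
Qed.

Lemma row_val_ord (c : srow) (x : nat -> nat) : size c.1 <= r ->
  row_val x c = (\sum_(i < r) (nth (0, 0) c.1 i).2 * (x (nth (0, 0) c.1 i).1)%:R)%R.
Proof.
move=> sz; rewrite /row_val (big_nth (0, 0%R)) big_mkord.
rewrite (big_ord_widen r (fun i => ((nth (0, 0) c.1 i).2 * (x (nth (0, 0) c.1 i).1)%:R))%R sz).
rewrite [RHS](bigID (fun i : 'I_r => i < size c.1)) /= [X in (_ + X)%R]big1 ?addr0 // => i.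
by rewrite -leqNgt => h; rewrite nth_default // mul0r.
Qed.

Lemma separates_sound J p a q : separates J p a -> q < d ^ r -> locally_feasible J q ->
  (dot J a q < dot J a p)%R.
Proof. by move=> /allP h qd; apply/implyP/h; rewrite mem_iota. Qed.

(** The row [c] itself separates [p] from the locally feasible points, as these satisfy [c];
    [small_positive_functional], applied to the differences of points, makes its coefficients small
    integers. Positions of [J] beyond the length of [c] carry the default column 0 with coefficient
    0. *)
Lemma separator_exists J p c :
  c \in S -> size c.1 <= r ->
  (forall i, i < r -> digit n i J = (nth (0, 0%R) c.1 i).1) ->
  excludes J p c ->
  has (separates J p) (iota 0 (cbase ^ r)).
Proof.
move=> cS sz hJ /andP[insc viol].
pose v (q : 'I_(d ^ r)) i : int :=
  (Posz (point r J p (digit n i J)) - Posz (point r J q (digit n i J)))%R.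
have hv q i : i < r -> `|v q i| <= d.
  move=> _; rewrite /v.
  by have := point_lt r J p (digit n i J); have := point_lt r J q (digit n i J); lia.
have [a [ha pos]] := small_positive_functional (fun i => (nth (0, 0%R) c.1 i).2) d0 hv.
have [i ir|code codeM hcode] := @digits_exist cbase r (fun i => `|(a i + Posz cbound)%R|) cbase_gt0.
  by have := ha i ir; rewrite /cbase /cbound; lia.
have hdig i : i < r -> cdigit code i = a i.
  by move=> ir; rewrite /cdigit hcode //; have := ha i ir; rewrite /cbound; lia.
apply/hasP; exists code; first by rewrite mem_iota.
apply/allP => q; rewrite mem_iota add0n => /= qd; apply/implyP => /allP /(_ _ cS).
rewrite /excludes insc /= -leNgt => hq.
rewrite -subr_gt0 /dot -sumrB.
have -> : (\sum_(i < r) (cdigit code i * Posz (point r J p (digit n i J)) -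
              cdigit code i * Posz (point r J q (digit n i J))) =
   \sum_(i < r) a i * v (Ordinal qd) i)%R.
  by apply: eq_bigr => i _; rewrite -mulrBr hdig.
apply: pos; have := le_lt_trans hq viol; rewrite -subr_gt0 !row_val_ord // -sumrB.
apply: etrans; congr (_ < _)%R; apply: eq_bigr => i _.
by rewrite /v intrB mulrBr hJ.
Qed.

(** The same [x] serves in both directions. If [x] violates an input row, take as scope its columns
    and as point the values of [x] there: the corresponding output row cuts off [x]. If [x]
    satisfies all input rows, its restriction to any scope is locally feasible and hence survives
    every separation. *)
Lemma kernel_equiv :
  (forall c, c \in S -> size c.1 <= r /\ forall e, e \in c.1 -> e.1 < n) ->
  (exists x : nat -> nat, (forall j, x j < d) /\
     forall k, k < knrows -> (\sum_(j < n) krow k j * Posz (x j) <= krhs k)%R) <->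
  (exists x : nat -> nat, (forall j, x j < d) /\
     forall c, c \in S -> (row_val x c <= c.2)%R).
Proof.
move=> hS; split=> -[x [xd hx]]; exists x; split=> //.
  move=> c cS; rewrite leNgt; apply/negP => viol; have [sz col] := hS c cS.
  have [i _|J Jn hJ] := @digits_exist n r (fun i => (nth (0, 0%R) c.1 i).1) n0.
    case: (ltnP i (size c.1)) => h; last by rewrite nth_default.
    by apply: col; rewrite mem_nth.
  have [i _|p pd hp] := @digits_exist d r (fun i => x (digit n i J)) d0; first exact: xd.
  pose k := p + J * d ^ r.
  have dr0 : 0 < d ^ r by rewrite expn_gt0 d0.
  have kJ : k %/ d ^ r = J by rewrite divnDMl // divn_small.
  have hk i : i < r -> digit d i k = x (digit n i J).
    by move=> ir; rewrite digit_addM // hp.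
  have kN : k < knrows by rewrite /knrows /k; nia.
  have insc : all (fun e => in_scope J e.1) c.1.
    apply/allP => e ec; have ic : index e c.1 < r by rewrite (leq_trans _ sz) ?index_mem.
    by apply/hasP; exists (index e c.1); rewrite ?mem_iota // hJ // nth_index.
  have hf : found k.
    rewrite /found kJ; apply: (separator_exists cS sz hJ).
    by rewrite /excludes insc (row_val_agrees hk).
  (* As the point [k] is the restriction of [x], output row [k] at [x] would say that a number is at
     most itself minus 1. *)
  have := hx k kN; rewrite /krow /krhs hf mul1r sum_coef kJ /dot.
  under [X in (_ <= X - _)%R]eq_bigr => i _ do rewrite (point_agrees hk) ?in_scope_digit //.
  by rewrite lerBrDr gerDl.
move=> k kN; rewrite /krow /krhs sum_coef; set J := k %/ d ^ r.
case hf: (found k); last first.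
  rewrite mul0r /best last_satN; last by move/negbT: hf.
  apply: sumr_le0 => i _; rewrite mulr_le0_ge0 //.
  by rewrite /cdigit /digit div0n mod0n sub0r oppr_le0.
rewrite mul1r; have sep : separates J k (best k) := last_satP hf.
have [i _|q qd hq] := @digits_exist d r (fun i => x (digit n i J)) d0; first exact: xd.
have lf : locally_feasible J q.
  apply/allP => c cS; apply/negP => /andP[insc].
  by rewrite (row_val_agrees hq) // ltNge hx.
have := separates_sound sep qd lf; rewrite {1}/dot.
under eq_bigr => i _ do rewrite (point_agrees hq) ?in_scope_digit //.
by rewrite -lezD1 lerBrDr.
Qed.

End Kernel.

(** * Running time: a logic of timed total correctness *)

Lemma bitlen_le z k : `|z| <= 2 ^ k -> bitlen z <= k.+2.
Proof. by move=> zk; rewrite /bitlen !ltnS -(@trunc_expnK 2 k) // leq_trunc_log. Qed.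

(** Made for [abs_eval_le]: [W] times the size is an exponent of 2 bounding the value. A memory
    access needs only one unit, because every cell is bounded by [2 ^ W] whatever its address. *)
Fixpoint expr_size (e : expr) : nat :=
  match e with
  | Cst z => `|z|.+1
  | Reg _ => 1
  | Defs.Mem a => (expr_size a).+1
  | Bin _ e1 e2 => expr_size e1 + expr_size e2
  end.

Fixpoint expr_weight (e : expr) : nat :=
  (expr_size e).+2 +
  match e with
  | Cst _ | Reg _ => 0
  | Defs.Mem a => expr_weight a
  | Bin _ e1 e2 => expr_weight e1 + expr_weight e2
  end.

(** A loop is charged [N.+1] rounds, the extra one covering the failing test. For a fixed command
    this is polynomial in [W] and [N]. *)
Fixpoint com_time (W N : nat) (c : com) : nat :=
  match c with
  | Skip => 1
  | Assign _ e | Write e => (W * expr_weight e).+1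
  | Store a e => (W * (expr_weight a + expr_weight e)).+1
  | Seq c1 c2 => com_time W N c1 + com_time W N c2
  | If e c1 c2 => (W * expr_weight e + (com_time W N c1 + com_time W N c2)).+1
  | While e c => N.+1 * (W * expr_weight e + com_time W N c).+1
  end.

(** A test succeeds if its value is positive, so the condition is [x < e]. As [e] is evaluated anew
    in each round, [wp_for] requires its value to be constant. *)
Definition For (x : nat) (e : expr) (body : com) : com :=
  Seq (Assign x (Cst 0))
      (While (Bin Defs.Sub e (Reg x)) (Seq body (Assign x (Bin Add (Reg x) (Cst 1))))).

Lemma expr_size_gt0 e : 0 < expr_size e.
Proof. by elim: e => //= o e1 h1 e2 h2; rewrite addn_gt0 h1. Qed.

Section TimeBound.

(* W bounds all registers and the bit lengths of all memory cells, N bounds the number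
   of iterations of each loop; the program never stores, so the memory is constant. *)
Variables (W N : nat) (m0 : int -> int).
Hypotheses (W0 : 0 < W) (hm0 : forall a, `|m0 a| <= 2 ^ W).

Definition good (s : state) : Prop := Defs.mem s = m0 /\ forall x, `|reg s x| <= W.

Lemma abs_eval_le s e : good s -> `|eval s e| <= 2 ^ (W * expr_size e).
Proof.
move=> [sm sr]; elim: e => [z|x|a IH|o e1 h1 e2 h2] /=.
- apply: leq_trans (ltnW (ltn_expl _ (isT : 1 < 2))) _; rewrite leq_exp2l //.
  by rewrite mulnS -[X in X <= _]mul1n (leq_trans _ (leq_addl _ _)) // leq_mul.
- by rewrite muln1 (leq_trans (sr x)) // ltnW // ltn_expl.
- by rewrite sm (leq_trans (hm0 _)) // leq_exp2l // mulnS leq_addr.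
- rewrite mulnDr expnD; set A := 2 ^ _ in h1 *; set B := 2 ^ _ in h2 *.
  (* Two bounds that are at least 2 have a sum at most their product, so the product also covers
     addition and subtraction. *)
  have A2 : 2 <= A by rewrite -{1}(expn1 2) leq_exp2l // muln_gt0 W0 expr_size_gt0.
  have B2 : 2 <= B by rewrite -{1}(expn1 2) leq_exp2l // muln_gt0 W0 expr_size_gt0.
  case: o => /=.
  + have : `|(eval s e1 + eval s e2)%R| <= `|eval s e1| + `|eval s e2| by lia.
    by nia.
  + have : `|(eval s e1 - eval s e2)%R| <= `|eval s e1| + `|eval s e2| by lia.
    by nia.
  + by rewrite abszM leq_mul.
  + by apply: leq_trans (lez_div _ _) _; nia.
Qed.

Lemma ecost_le s e : good s -> ecost s e <= W * expr_weight e.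
Proof.
move=> sg.
have h e' : bitlen (eval s e') <= W * (expr_size e').+2.
  apply: leq_trans (bitlen_le (abs_eval_le e' sg)) _.
  by rewrite !mulnS; move: (W * expr_size e') => y; lia.
elim: e => [z|x|a IH|o e1 h1 e2 h2]; rewrite [ecost _ _]/= [expr_weight _]/= mulnDr;
  apply: leq_add => //; first exact: (h (Cst z)).
- exact: (h (Reg x)).
- exact: (h (Defs.Mem a)).
- exact: (h (Bin o e1 e2)).
- by rewrite mulnDr leq_add.
Qed.

(** Termination within [com_time] is part of the triple, so the time bound comes along with
    functional correctness. *)
Definition wp (c : com) (s : state) (Q : state -> Prop) : Prop :=
  exists t s', [/\ exec c s t s', t <= com_time W N c & Q s'].

Lemma wp_weaken c s (Q Q' : state -> Prop) :
  wp c s Q -> (forall s', Q s' -> Q' s') -> wp c s Q'.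
Proof. by move=> [t [s' [ex tt q]]] h; exists t, s'; split; auto. Qed.

Lemma wp_skip s (Q : state -> Prop) : Q s -> wp Skip s Q.
Proof. by move=> q; exists 1, s; split=> //; constructor. Qed.

Lemma wp_assign x e s (Q : state -> Prop) :
  good s -> Q (set_reg s x (eval s e)) -> wp (Assign x e) s Q.
Proof.
by move=> sg q; do 2!eexists; split; [constructor | rewrite /= ltnS ecost_le | ].
Qed.

Lemma wp_write e s (Q : state -> Prop) :
  good s -> Q (emit s (eval s e)) -> wp (Write e) s Q.
Proof.
by move=> sg q; do 2!eexists; split; [constructor | rewrite /= ltnS ecost_le | ].
Qed.

Lemma wp_seq c1 c2 s (Q : state -> Prop) :
  wp c1 s (fun s' => wp c2 s' Q) -> wp (Seq c1 c2) s Q.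
Proof.
move=> [t1 [s1 [ex1 h1 [t2 [s2 [ex2 h2 q]]]]]].
by exists (t1 + t2), s2; split; [apply: ExecSeq ex1 ex2 | apply: leq_add | ].
Qed.

Lemma wp_if e c1 c2 s (Q : state -> Prop) :
  good s -> wp (if (0 < eval s e)%R then c1 else c2) s Q -> wp (If e c1 c2) s Q.
Proof.
move=> sg; have := ecost_le e sg; case: ltrP => h hc [t [s' [ex tt q]]];
  exists (ecost s e + t).+1, s'; split=> //.
- exact: ExecIfTrue.
- by rewrite /= ltnS leq_add // (leq_trans tt) ?leq_addr.
- exact: ExecIfFalse.
- by rewrite /= ltnS leq_add // (leq_trans tt) ?leq_addl.
Qed.

(** The invariant is taken at the loop test. The body is therefore followed by the increment already
    in the postcondition, and must leave the counter intact. *)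
Lemma wp_for (m x : nat) e body (Inv : nat -> state -> Prop) s (Q : state -> Prop) :
  m <= N -> good s -> Inv 0 (set_reg s x 0%R) ->
  (forall i s, Inv i s -> [/\ good s, reg s x = Posz i & eval s e = Posz m]) ->
  (forall i s, i < m -> Inv i s -> wp body s
     (fun s' => [/\ good s', reg s' x = Posz i & Inv i.+1 (set_reg s' x (Posz i.+1))])) ->
  (forall s, Inv m s -> Q s) ->
  wp (For x e body) s Q.
Proof.
move=> mN sg inv0 hInv hbody hQ; apply: wp_seq; apply: wp_assign => //.
move: inv0; rewrite /=; move: (set_reg s x 0%R) => {sg}s inv0.
set cond := Bin Defs.Sub _ _; set body' := Seq _ _.
set Tc := (W * expr_weight cond + com_time W N body').+1.
(* Here [k] is the number of remaining rounds, so [k.+1] tests are still to come. *)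
suff loop k i s1 : i + k = m -> Inv i s1 ->
    exists t s', [/\ exec (While cond body') s1 t s', t <= k.+1 * Tc & Q s'].
  have [t [s' [ex ht q]]] := loop m 0 s erefl inv0.
  by exists t, s'; split=> //; apply: leq_trans ht _; rewrite leq_mul2r ltnS mN orbT.
elim: k i s1 => [|k IH] i s1 ikm inv1; have [g1 x1 e1] := hInv _ _ inv1.
  exists (ecost s1 cond).+1, s1; split.
  - by apply: ExecWhileFalse; rewrite /= e1 x1; lia.
  - by rewrite mul1n ltnS (leq_trans (ecost_le cond g1)) ?leq_addr.
  - by apply: hQ; rewrite -ikm addn0.
have im : i < m by lia.
have [t1 [s2 [ex1 ht1 [g2 x2 inv2]]]] := hbody _ _ im inv1.
have [|t2 [s3 [ex2 ht2 q]]] := IH i.+1 _ _ inv2; first by lia.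
pose inc := Bin Add (Reg x) (Cst 1).
exists (ecost s1 cond + (t1 + (ecost s2 inc).+1) + t2).+1, s3; split=> //.
  apply: ExecWhileTrue ex2; first by rewrite /= e1 x1; lia.
  apply: ExecSeq ex1 _; have -> : Posz i.+1 = eval s2 inc by rewrite /= x2; lia.
  exact: ExecAssign.
have h2 : t1 + (ecost s2 inc).+1 <= com_time W N body'.
  by rewrite [com_time _ _ _]/= -/(expr_weight inc) leq_add // ltnS (ecost_le inc g2).
have h1 : ecost s1 cond + (t1 + (ecost s2 inc).+1) < Tc by rewrite ltnS leq_add ?ecost_le.
by rewrite [k.+2 * _]mulSn -addSn; apply: leq_add.
Qed.

End TimeBound.

(* Expressions for powers, digits and truth values, the latter being 0 and 1 *)
Declare Scope expr_scope.
Delimit Scope expr_scope with X.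
Bind Scope expr_scope with expr.
Local Notation "a + b" := (Bin Add a b) : expr_scope.
Local Notation "a - b" := (Bin Defs.Sub a b) : expr_scope.
Local Notation "a * b" := (Bin Mul a b) : expr_scope.
Local Notation "a / b" := (Bin Div a b) : expr_scope.
Local Notation "0" := (Cst 0) : expr_scope.
Local Notation "1" := (Cst 1) : expr_scope.

Fixpoint ePow (b : expr) (i : nat) : expr :=
  if i is i'.+1 then (b * ePow b i')%X else 1%X.

Definition eDigit (b : expr) (i : nat) (v : expr) : expr :=
  (v / ePow b i - b * ((v / ePow b i) / b))%X.

(** The divisor is 1 if [a] and [b] agree and exceeds 1 otherwise, which makes the quotient 1 or
    0. *)
Definition eEq (a b : expr) : expr := (1 / (1 + (a - b) * (a - b)))%X.

(** The absolute value of [a] is less than [1 + a * a] and remainders are nonnegative, so the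
    quotient is 0 for nonnegative [a] and -1 for negative [a]. *)
Definition eGe0 (a : expr) : expr := (1 + a / (1 + a * a))%X.

Definition eNot (a : expr) : expr := (1 - a)%X.

Definition eOr (a b : expr) : expr := eNot (eNot a * eNot b)%X.

Fixpoint eSum (k : nat) (F : nat -> expr) : expr :=
  if k is k'.+1 then (eSum k' F + F k')%X else 0%X.

Fixpoint eHas (k : nat) (F : nat -> expr) : expr :=
  if k is k'.+1 then eOr (eHas k' F) (F k') else 0%X.

Fixpoint eAll (k : nat) (F : nat -> expr) : expr :=
  if k is k'.+1 then (eAll k' F * F k')%X else 1%X.

Section EvalBasic.

Variable s : state.

Lemma eval_ePow eb b i : eval s eb = Posz b -> eval s (ePow eb i) = Posz (b ^ i).
Proof. by move=> hb; elim: i => //= i ->; rewrite hb expnS. Qed.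

Lemma eval_eDigit eb b i ev v : eval s eb = Posz b -> eval s ev = Posz v ->
  eval s (eDigit eb i ev) = Posz (digit b i v).
Proof.
move=> hb hv; rewrite /= (eval_ePow i hb) hb hv !divz_nat /digit.
by rewrite {1}(divn_eq (v %/ b ^ i) b) mulnC; lia.
Qed.

Lemma eval_eEq a b : eval s (eEq a b) = Posz (eval s a == eval s b).
Proof.
rewrite /=; case: eqP => [->|ne]; first by rewrite subrr mulr0.
by rewrite divz_small //; apply/andP; split=> //; nia.
Qed.

Lemma eval_eGe0 a : eval s (eGe0 a) = Posz (0 <= eval s a)%R.
Proof.
rewrite /=; move: (eval s a) => x; case: (lerP 0 x) => x0.
  by rewrite divz_small ?addr0 // x0 /=; nia.
suff -> : (x %/ (1 + x * x))%Z = (- 1)%R by [].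
have h : (x = - 1 * (1 + x * x) + (1 + x * x + x))%R by ring.
rewrite {1}h divzMDl ?divz_small ?addr0 //; last by nia.
by apply/andP; split; nia.
Qed.

Lemma eval_eNot a (b : bool) : eval s a = Posz b -> eval s (eNot a) = Posz (~~ b).
Proof. by move=> /= ->; case: b. Qed.

Lemma eval_eAnd a b (p q : bool) : eval s a = Posz p -> eval s b = Posz q ->
  eval s (a * b)%X = Posz (p && q).
Proof. by move=> /= -> ->; case: p; case: q. Qed.

Lemma eval_eOr a b (p q : bool) : eval s a = Posz p -> eval s b = Posz q ->
  eval s (eOr a b) = Posz (p || q).
Proof. by move=> /= -> ->; case: p; case: q. Qed.

Lemma eval_eSum k F : eval s (eSum k F) = (\sum_(i < k) eval s (F i))%R.
Proof. by elim: k => [|k IH]; rewrite ?big_ord0 // big_ord_recr -IH. Qed.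

Lemma eval_eHas k F (P : pred nat) : (forall i, i < k -> eval s (F i) = Posz (P i)) ->
  eval s (eHas k F) = Posz (has P (iota 0 k)).
Proof.
elim: k => // k IH h; rewrite has_iotaS.
by apply: eval_eOr; [apply: IH => i ik; apply/h/ltnW | apply: h].
Qed.

Lemma eval_eAll k F (P : pred nat) : (forall i, i < k -> eval s (F i) = Posz (P i)) ->
  eval s (eAll k F) = Posz (all P (iota 0 k)).
Proof.
elim: k => // k IH h; rewrite all_iotaS.
by apply: eval_eAnd; [apply: IH => i ik; apply/h/ltnW | apply: h].
Qed.

End EvalBasic.

Fixpoint eCoefBound (k : nat) (eD : expr) : expr :=
  if k is k'.+1
  then (Cst (Posz (2 * k)) * (eD * eD) * eCoefBound k' (Cst 2 * (eD * eD)))%X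
  else 1%X.

Lemma eval_eCoefBound s k eD D :
  eval s eD = Posz D -> eval s (eCoefBound k eD) = Posz (coef_bound k D).
Proof.
elim: k eD D => // k IH eD D hD.
by rewrite [LHS]/= (IH _ (2 * (D * D))) /= ?hD //=.
Qed.

(** * Layout of encoded rows, and expressions for the kernel *)

Definition enc_srow (c : srow) : seq int :=
  Posz (size c.1) :: flatten [seq Posz e.1 :: enc_rat e.2 | e <- c.1] ++ enc_rat c.2.

Lemma size_enc_srow c : size (enc_srow c) = 3 + 3 * size c.1.
Proof.
have h : size (flatten [seq Posz e.1 :: enc_rat e.2 | e <- c.1]) = 3 * size c.1.
  by elim: c.1 => //= e l IH; rewrite IH mulnS.
by rewrite /= size_cat h /=; lia.
Qed.

Lemma nth_enc_entries (l : seq (nat * rat)) z i :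
  i < size l ->
  [/\ nth 0%R (flatten [seq Posz e.1 :: enc_rat e.2 | e <- l] ++ z) (3 * i) =
        Posz (nth (0, 0%R) l i).1,
      nth 0%R (flatten [seq Posz e.1 :: enc_rat e.2 | e <- l] ++ z) (3 * i).+1 =
        numq (nth (0, 0%R) l i).2 &
      nth 0%R (flatten [seq Posz e.1 :: enc_rat e.2 | e <- l] ++ z) (3 * i).+2 =
        denq (nth (0, 0%R) l i).2].
Proof.
elim: l i => // e l IH [|i] il //; have [h1 h2 h3] := IH i il.
by rewrite mulnS; split.
Qed.

Lemma nth_enc_rhs (l : seq (nat * rat)) b :
  nth 0%R (flatten [seq Posz e.1 :: enc_rat e.2 | e <- l] ++ enc_rat b) (3 * size l) = numq b /\
  nth 0%R (flatten [seq Posz e.1 :: enc_rat e.2 | e <- l] ++ enc_rat b) (3 * size l).+1 = denq b.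
Proof.
elim: l => [|e l IH]; first by rewrite muln0.
by rewrite [size _]/= mulnS.
Qed.

Section EvalKernel.

Variables (r : nat) (eN eD : expr).

(** The case distinction becomes a sum of two products with complementary truth values. *)
Fixpoint ePoint (k : nat) (J q col : expr) : expr :=
  if k is k'.+1 then
    (eEq (eDigit eN k' J) col * eDigit eD k' q +
       eNot (eEq (eDigit eN k' J) col) * ePoint k' J q col)%X
  else 0%X.

Definition eInScope (J col : expr) : expr := eHas r (fun i => eEq (eDigit eN i J) col).

Definition eBase : expr := (Cst 2 * eCoefBound r eD + 1)%X.

Definition eCdigit (a : expr) (i : nat) : expr := (eDigit eBase i a - eCoefBound r eD)%X.

Definition eCoef (J a j : expr) : expr :=
  eSum r (fun i => eCdigit a i * eEq (eDigit eN i J) j)%X.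

Definition eDot (J a q : expr) : expr :=
  eSum r (fun i => eCdigit a i * ePoint r J q (eDigit eN i J))%X.

(* P is the address of an input row; entries with index at least the length of
   the row are masked. *)
Definition eIsEntry (P : expr) (i : nat) : expr :=
  eGe0 (Defs.Mem P - Cst (Posz i.+1))%X.

Definition eCell (P : expr) (i k : nat) : expr :=
  Defs.Mem (P + Cst (Posz (3 * i + k)))%X.

(** The machine has only integers, so the value of a row at a point is kept as the fraction
    [eRowNum / eRowDen] over the product of the denominators. A masked position contributes the
    factor 1 and the summand 0. *)
Fixpoint eRowDen (P : expr) (k : nat) : expr :=
  if k is k'.+1 then
    (eRowDen P k' * (eIsEntry P k' * eCell P k' 3 + eNot (eIsEntry P k')))%X
  else 1%X.

Fixpoint eRowNum (P J q : expr) (k : nat) : expr :=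
  if k is k'.+1 then
    (eRowNum P J q k' * (eIsEntry P k' * eCell P k' 3 + eNot (eIsEntry P k')) +
     eIsEntry P k' * eCell P k' 2 * ePoint r J q (eCell P k' 1) * eRowDen P k')%X
  else 0%X.

Definition eFits (P J : expr) : expr :=
  eAll r (fun i => eOr (eNot (eIsEntry P i)) (eInScope J (eCell P i 1))).

(** The numerator and denominator of the right-hand side follow the [3 * Mem P] cells of the
    entries. Both denominators are positive, so the comparison is done by cross multiplication. *)
Definition eExcludes (P J q : expr) : expr :=
  (eFits P J *
   eNot (eGe0 (Defs.Mem (P + 1 + Cst 3 * Defs.Mem P) * eRowDen P r -
               eRowNum P J q r * Defs.Mem (P + Cst 2 + Cst 3 * Defs.Mem P))))%X.

Variables (s : state) (n d : nat).
Hypotheses (hN : eval s eN = Posz n) (hD : eval s eD = Posz d) (d0 : 0 < d).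

Lemma eval_ePoint k eJ J eq q ec c :
  eval s eJ = Posz J -> eval s eq = Posz q -> eval s ec = Posz c ->
  eval s (ePoint k eJ eq ec) = Posz (point n d k J q c).
Proof.
move=> hJ hq hc; elim: k => // k IH; rewrite [point _ _ _ _ _ _]/=.
have he := eval_eEq s (eDigit eN k eJ) ec.
rewrite (eval_eDigit k hN hJ) hc in he.
have hn := eval_eNot he.
change (eval s (eEq (eDigit eN k eJ) ec) * eval s (eDigit eD k eq) +
  eval s (eNot (eEq (eDigit eN k eJ) ec)) * eval s (ePoint k eJ eq ec) =
  Posz (if digit n k J == c then digit d k q else point n d k J q c))%R.
rewrite he hn IH (eval_eDigit k hD hq) eqz_nat.
by case: eqP => _; rewrite /= ?mul1r ?mul0r ?addr0 ?add0r.
Qed.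

Lemma eval_eInScope eJ J ec c : eval s eJ = Posz J -> eval s ec = Posz c ->
  eval s (eInScope eJ ec) = Posz (in_scope r n J c).
Proof.
move=> hJ hc; apply: eval_eHas => i _.
by rewrite eval_eEq (eval_eDigit i hN hJ) hc.
Qed.

Lemma eval_eBase : eval s eBase = Posz (cbase r d).
Proof. by rewrite [LHS]/= (eval_eCoefBound r hD). Qed.

Lemma eval_eCdigit ea a i : eval s ea = Posz a ->
  eval s (eCdigit ea i) = cdigit r d a i.
Proof.
move=> ha; rewrite /cdigit -(eval_eDigit i eval_eBase ha) /cbound.
by rewrite -(eval_eCoefBound r hD).
Qed.

Lemma eval_eCoef eJ J ea a ej j :
  eval s eJ = Posz J -> eval s ea = Posz a -> eval s ej = Posz j ->
  eval s (eCoef eJ ea ej) = coef r n d J a j.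
Proof.
move=> hJ ha hj; rewrite eval_eSum; apply: eq_bigr => i _.
change (eval s (eCdigit ea i) * eval s (eEq (eDigit eN i eJ) ej) =
  cdigit r d a i * Posz (digit n i J == j))%R.
by rewrite (eval_eCdigit _ ha) eval_eEq (eval_eDigit i hN hJ) hj.
Qed.

Lemma eval_eDot eJ J ea a eq q :
  eval s eJ = Posz J -> eval s ea = Posz a -> eval s eq = Posz q ->
  eval s (eDot eJ ea eq) = dot r n d J a q.
Proof.
move=> hJ ha hq; rewrite eval_eSum; apply: eq_bigr => i _.
change (eval s (eCdigit ea i) * eval s (ePoint r eJ eq (eDigit eN i eJ)) =
  cdigit r d a i * Posz (point n d r J q (digit n i J)))%R.
by rewrite (eval_eCdigit _ ha) (eval_ePoint r hJ hq (eval_eDigit i hN hJ)).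
Qed.

Section Row.

Variables (c : srow) (eP eJ eq : expr) (P J q : nat).
Hypotheses (hP : eval s eP = Posz P) (hJ : eval s eJ = Posz J) (hq : eval s eq = Posz q)
  (hrow : forall t, t < size (enc_srow c) -> Defs.mem s (Posz (P + t)) = nth 0%R (enc_srow c) t)
  (sz : size c.1 <= r).

Let ent i := nth (0, 0%R) c.1 i.

Lemma mem_row0 : Defs.mem s (Posz P) = Posz (size c.1).
Proof. by rewrite -[P]addn0 hrow. Qed.

Lemma eval_eIsEntry i : eval s (eIsEntry eP i) = Posz (i < size c.1).
Proof. by rewrite eval_eGe0 /= hP mem_row0 subr_ge0. Qed.

Lemma eval_eCell i : i < size c.1 ->
  [/\ eval s (eCell eP i 1) = Posz (ent i).1, eval s (eCell eP i 2) = numq (ent i).2 &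
      eval s (eCell eP i 3) = denq (ent i).2].
Proof.
move=> ic; have [h1 h2 h3] := nth_enc_entries (enc_rat c.2) ic.
rewrite /= hP -!PoszD !hrow ?size_enc_srow; [|lia..].
by rewrite addn1 addn2 addn3 /= -h1 -h2 -h3.
Qed.

Lemma eval_eFits :
  eval s (eFits eP eJ) = Posz (all (fun e => in_scope r n J e.1) c.1).
Proof.
have -> : all (fun e => in_scope r n J e.1) c.1 =
   all (fun i => ~~ (i < size c.1) || in_scope r n J (ent i).1) (iota 0 r).
  apply/allP/allP => [h i _|h e ec]; first case: (ltnP i (size c.1)) => //= ic.
    by rewrite h ?mem_nth.
  have ic : index e c.1 < size c.1 by rewrite index_mem.
  have := h (index e c.1); rewrite mem_iota add0n /ent nth_index // ic /=.
  by apply; rewrite (leq_trans ic).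
apply: eval_eAll => i ir; case: (ltnP i (size c.1)) => ic.
  apply: (eval_eOr (p := false)).
    by apply: (eval_eNot (b := true)); rewrite eval_eIsEntry ic.
  by apply: eval_eInScope => //; case: (eval_eCell ic).
(* Past the last entry nothing is known about the cell, and [eInScope] need not be a truth value;
   the mask multiplies its contribution by 0. *)
have h0 := eval_eIsEntry i; rewrite ltnNge ic /= in h0.
by rewrite /= in h0 *; rewrite h0 subr0 subrr mul0r.
Qed.

Lemma eval_eRow k :
  (0 < eval s (eRowDen eP k))%R /\
  ((eval s (eRowNum eP eJ eq k))%:~R = (eval s (eRowDen eP k))%:~R *
     \sum_(i < k) (ent i).2 * (point n d r J q (ent i).1)%:R :> rat)%R.
Proof.
elim: k => [|k [IH1 IH2]]; first by rewrite big_ord0 mulr0.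
rewrite big_ord_recr.
set D := eval s (eRowDen eP k) in IH1 IH2; set M := eval s (eRowNum eP eJ eq k) in IH2.
change ((0 < D * (eval s (eIsEntry eP k) * eval s (eCell eP k 3) +
                 (1 - eval s (eIsEntry eP k))))%R /\
  ((M * (eval s (eIsEntry eP k) * eval s (eCell eP k 3) + (1 - eval s (eIsEntry eP k))) +
    eval s (eIsEntry eP k) * eval s (eCell eP k 2) *
      eval s (ePoint r eJ eq (eCell eP k 1)) * D)%:~R =
   (D * (eval s (eIsEntry eP k) * eval s (eCell eP k 3) +
                 (1 - eval s (eIsEntry eP k))))%:~R *
   (\sum_(i < k) (ent i).2 * (point n d r J q (ent i).1)%:R +
     (ent k).2 * (point n d r J q (ent k).1)%:R) :> rat)%R).
rewrite eval_eIsEntry; case: (ltnP k (size c.1)) => kc; last first.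
  rewrite !mul0r subr0 add0r !mulr1 addr0 /ent [nth _ _ k]nth_default //.
  by rewrite mul0r addr0.
have [h1 h2 h3] := eval_eCell kc; rewrite (eval_ePoint r hJ hq h1) h2 h3.
rewrite subrr addr0 !mul1r; split; first by rewrite mulr_gt0 ?denq_gt0.
rewrite intrD !intrM IH2 mulrDr; congr (_ + _)%R; first by ring.
rewrite -{3}[(ent k).2]divq_num_den pmulrn; field.
by rewrite intr_eq0 denq_neq0.
Qed.

Lemma eval_eExcludes :
  eval s (eExcludes eP eJ eq) = Posz (excludes r n d J q c).
Proof.
apply: eval_eAnd; first exact: eval_eFits.
rewrite ltNge; apply: eval_eNot; rewrite eval_eGe0.
have [h1 h2] := eval_eRow r; have [hn hd] := nth_enc_rhs c.1 c.2.
set D := eval s (eRowDen eP r) in h1 h2; set M := eval s (eRowNum eP eJ eq r) in h2.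
change (Posz (0 <= Defs.mem s (eval s eP + 1 + Posz 3 * Defs.mem s (eval s eP)) * D -
   M * Defs.mem s (eval s eP + Posz 2 + Posz 3 * Defs.mem s (eval s eP)))%R =
   Posz (row_val (point n d r J q) c <= c.2)%R).
rewrite hP mem_row0 -PoszM -!PoszD -!addnA !hrow ?size_enc_srow; [|lia..].
rewrite !addSn !add0n /= hn hd subr_ge0; congr (Posz (nat_of_bool _)).
rewrite (row_val_ord _ sz) -/ent.
rewrite -[in RHS](divq_num_den c.2) ler_pdivlMr ?ltr0z ?denq_gt0 //.
rewrite -(ler_int rat) !intrM h2 -mulrA (mulrC _ D%:~R)%R ler_pM2l ?ltr0z //.
Qed.

End Row.

End EvalKernel.

(** * The program and its correctness *)

(** A frame condition: inner parts of the program write only to registers with higher numbers, so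
    the counters of the outer loops survive. *)
Definition agree (b : nat) (s s' : state) : Prop := forall y, y < b -> reg s' y = reg s y.

Lemma agree_set b s s' x v : agree b s s' -> b <= x -> agree b s (set_reg s' x v).
Proof. by move=> h bx y yb; rewrite /= ltn_eqF ?h // (leq_trans yb). Qed.

Lemma agree_trans b b' s1 s2 s3 : agree b s1 s2 -> agree b' s2 s3 -> b <= b' -> agree b s1 s3.
Proof. by move=> h1 h2 bb y yb; rewrite h2 ?h1 // (leq_trans yb). Qed.

Lemma good_set W m0 s x v : good W m0 s -> `|v| <= W -> good W m0 (set_reg s x v).
Proof. by move=> [sm sr] vW; split=> // y /=; case: eqP. Qed.

Lemma iota_rcons i : iota 0 i.+1 = rcons (iota 0 i) i.
Proof. by rewrite -addn1 iotaD cats1. Qed.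

Definition krow_enc r n d S (k : nat) : seq int :=
  Posz (count (fun j => krow r n d S k j != 0%R) (iota 0 n)) ::
    flatten [seq [:: Posz j; krow r n d S k j; 1%R] |
               j <- iota 0 n & krow r n d S k j != 0%R] ++ [:: krhs r n d S k; 1%R].

Definition sys_enc (S : seq srow) : seq int := flatten [seq enc_srow c | c <- S].

(** The first 3 cells hold the numbers of columns, values and rows. *)
Definition row_addr (S : seq srow) (l : nat) : nat := 3 + size (sys_enc (take l S)).

(* Registers: 0 output row, 1 best code so far, 2 some code found, 3 candidate code or
   output column, 4 candidate valid or number of nonzero coefficients, 5 point,
   6 point locally feasible, 7 address of the input row, 8 index of the input row. *)
Section Program.

Variables (r : nat) (eN eD : expr).

Definition eScope : expr := (Reg 0 / ePow eD r)%X.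

Definition check_rows : com :=
  Seq (Assign 6 1%X) (Seq (Assign 7 (Cst 3))
    (For 8 (Defs.Mem (Cst 2))
      (Seq (Assign 6 (Reg 6 * eNot (eExcludes r eN eD (Reg 7) eScope (Reg 5)))%X)
           (Assign 7 (Reg 7 + (Cst 3 + Cst 3 * Defs.Mem (Reg 7)))%X)))).

Definition eDotLe : expr :=
  eGe0 (eDot r eN eD eScope (Reg 3) (Reg 5) - eDot r eN eD eScope (Reg 3) (Reg 0))%X.

Definition check_points : com :=
  Seq (Assign 4 1%X)
    (For 5 (ePow eD r)
      (Seq check_rows (Assign 4 (Reg 4 * eNot (Reg 6 * eDotLe))%X))).

(** Register 4 is 0 or 1, so the assignment to register 1 selects between the old code and the
    candidate without branching. *)
Definition search : com :=
  Seq (Assign 1 0%X) (Seq (Assign 2 0%X)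
    (For 3 (ePow (eBase r eD) r)
      (Seq check_points
        (Seq (Assign 1 (Reg 1 + Reg 4 * (Reg 3 - Reg 1))%X)
             (Assign 2 (eOr (Reg 2) (Reg 4))))))).

Definition eEntry : expr := eCoef r eN eD eScope (Reg 1) (Reg 3).

Definition eNonzero : expr := eNot (eEq eEntry 0%X).

(** The output tape is write-only and the number of nonzero entries comes first, hence two passes:
    one to count, one to write. Each written 1 is a denominator. *)
Definition write_row : com :=
  Seq (Assign 4 0%X)
   (Seq (For 3 eN (Assign 4 (Reg 4 + eNonzero)%X))
     (Seq (Write (Reg 4))
       (Seq (For 3 eN
              (If eNonzero (Seq (Write (Reg 3)) (Seq (Write eEntry) (Write 1%X))) Skip))
         (Seq (Write (Reg 2 * (eDot r eN eD eScope (Reg 1) (Reg 0) - 1))%X)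
              (Write 1%X))))).

Definition eRows : expr := (ePow eN r * ePow eD r)%X.

Definition kernelize : com :=
  Seq (Write eN) (Seq (Write eD) (Seq (Write eRows)
    (For 0 eRows (Seq search write_row)))).

Variables (n d W : nat) (S : seq srow) (m0 : int -> int).
Hypotheses
  (hN : forall s, Defs.mem s = m0 -> eval s eN = Posz n)
  (hD : forall s, Defs.mem s = m0 -> eval s eD = Posz d)
  (n0 : 0 < n) (d0 : 0 < d)
  (hsize : m0 (Posz 2) = Posz (size S))
  (hrows : forall l t, l < size S -> t < size (enc_srow (nth ([::], 0%R) S l)) ->
     m0 (Posz (row_addr S l + t)) = nth 0%R (enc_srow (nth ([::], 0%R) S l)) t)
  (hsparse : forall c, c \in S -> size c.1 <= r)
  (W0 : 0 < W) (hm0 : forall a, `|m0 a| <= 2 ^ W)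
  (hW : [/\ n <= W, d ^ r <= W, cbase r d ^ r <= W, knrows r n d <= W &
        row_addr S (size S) <= W]).

Local Notation good := (good W m0).
Local Notation wp := (wp W W).

Lemma row_addrS l : l < size S ->
  row_addr S l.+1 = row_addr S l + (3 + 3 * size (nth ([::], 0%R) S l).1).
Proof.
move=> lS; rewrite /row_addr /sys_enc (take_nth ([::], 0%R) lS) map_rcons flatten_rcons.
by rewrite size_cat size_enc_srow addnA.
Qed.

Lemma row_addr_le l : l <= size S -> row_addr S l <= W.
Proof.
move=> lS; case: hW => _ _ _ _; apply: leq_trans.
rewrite /row_addr leq_add2l take_size -{2}(cat_take_drop l S) /sys_enc map_cat flatten_cat.
by rewrite size_cat leq_addr.
Qed.

Lemma size_sys_le : size S <= W.
Proof.
apply: leq_trans (row_addr_le (leqnn _)); rewrite /row_addr take_size.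
apply: leq_trans (leq_addl _ _); rewrite /sys_enc; elim: (S) => //= c l IH.
by rewrite ltnS size_cat (leq_trans IH) // -[X in X <= _]add0n leq_add.
Qed.

Lemma eval_eScope s k : good s -> reg s 0 = Posz k -> eval s eScope = Posz (k %/ d ^ r).
Proof. by move=> [sm _] h0; rewrite /= (eval_ePow r (hD sm)) h0 divz_nat. Qed.

Lemma wp_check_rows s k q : good s -> reg s 0 = Posz k -> reg s 5 = Posz q ->
  wp check_rows s (fun s' => [/\ good s', agree 6 s s', out s' = out s &
    reg s' 6 = Posz (locally_feasible r n d S (k %/ d ^ r) q)]).
Proof.
move=> gs k0 q0; apply: wp_seq; apply: (wp_assign _ W0 hm0) => //.
have g1 : good (set_reg s 6 (eval s 1%X)) by apply: good_set.
apply: wp_seq; apply: (wp_assign _ W0 hm0) => //.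
have g2 : good (set_reg (set_reg s 6 (eval s 1%X)) 7 3).
  by apply: good_set => //; apply: leq_trans (row_addr_le (leq0n _)); rewrite /row_addr.
pose Inv i s' := [/\ good s', agree 6 s s', out s' = out s, reg s' 8 = Posz i &
  reg s' 6 = Posz (all (fun c => ~~ excludes r n d (k %/ d ^ r) q c) (take i S)) /\
  reg s' 7 = Posz (row_addr S i)].
apply: (@wp_for W W m0 W0 hm0 (size S) _ _ _ Inv) => //.
- exact: size_sys_le.
- split=> //; [exact: good_set | | by rewrite /= /row_addr take0].
  by do 3!apply: agree_set => //.
- by move=> i s' [g' _ _ h8 _]; split=> //; case: g' => /= -> _.
- move=> i s' iS [g' ag ho h8 [h6 h7]]; case: (g') => sm sr.
  set c := nth ([::], 0%R) S i; have cS : c \in S by rewrite mem_nth.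
  have hrow t : t < size (enc_srow c) ->
      Defs.mem s' (Posz (row_addr S i + t)) = nth 0%R (enc_srow c) t.
    by move=> tc; rewrite sm hrows.
  have hex : eval s' (eExcludes r eN eD (Reg 7) eScope (Reg 5)) =
      Posz (excludes r n d (k %/ d ^ r) q c).
    apply: (eval_eExcludes (hN sm) (hD sm) d0 (h7 : eval s' (Reg 7) = _) _ _ hrow (hsparse cS)).
      by apply: eval_eScope; rewrite ?ag.
    by rewrite -q0 -ag.
  have h6' := eval_eAnd (h6 : eval s' (Reg 6) = _) (eval_eNot hex).
  apply: wp_seq; apply: (wp_assign _ W0 hm0) => //; rewrite h6'.
  have g6 : good (set_reg s' 6 (Posz (all (fun c => ~~ excludes r n d (k %/ d ^ r) q c)
      (take i S) && ~~ excludes r n d (k %/ d ^ r) q c))).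
    by apply: good_set => //; apply: leq_trans (leq_b1 _) W0.
  apply: (wp_assign _ W0 hm0) => //.
  set v := eval _ _; have -> : v = Posz (row_addr S i.+1).
    by rewrite /v /= h7 (mem_row0 hrow) row_addrS //; lia.
  split; [ | by [] | split].
  + by apply: good_set => //; apply: row_addr_le.
  + apply: good_set; last by rewrite (leq_trans iS) ?size_sys_le.
    by apply: good_set => //; apply: row_addr_le.
  + by do 3!apply: agree_set => //.
  + by [].
  + by [].
  + by rewrite /= (take_nth ([::], 0%R) iS) all_rcons andbC.
- by move=> s' [g' ag ho h8 [h6 _]]; split=> //; rewrite h6 take_size.
Qed.

Lemma wp_check_points s k a : good s -> reg s 0 = Posz k -> reg s 3 = Posz a ->
  wp check_points s (fun s' => [/\ good s', agree 4 s s', out s' = out s &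
    reg s' 4 = Posz (separates r n d S (k %/ d ^ r) k a)]).
Proof.
move=> gs k0 a0; case: (hW) => _ hdW _ _ _; apply: wp_seq; apply: (wp_assign _ W0 hm0) => //.
have g1 : good (set_reg s 4 (eval s 1%X)) by apply: good_set.
pose Inv i s' := [/\ good s', agree 4 s s', out s' = out s, reg s' 5 = Posz i &
  reg s' 4 = Posz (all (fun q => locally_feasible r n d S (k %/ d ^ r) q ==>
    (dot r n d (k %/ d ^ r) a q < dot r n d (k %/ d ^ r) a k)%R) (iota 0 i))].
apply: (@wp_for W W m0 W0 hm0 (d ^ r) _ _ _ Inv) => //.
- by split=> //; [exact: good_set | do 2!apply: agree_set => //].
- by move=> i s' [g' _ _ h5 _]; split=> //; apply: eval_ePow; apply: hD; case: g'.
- move=> i s' id [g' ag ho h5 h4]; apply: wp_seq.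
  have k0' : reg s' 0 = Posz k by rewrite ag.
  apply: wp_weaken (wp_check_rows g' k0' h5) _ => s2 [g2 ag2 ho2 h6].
  have k02 : reg s2 0 = Posz k by rewrite ag2.
  have a02 : reg s2 3 = Posz a by rewrite ag2 // ag.
  have q02 : reg s2 5 = Posz i by rewrite ag2.
  case: (g2) => sm _; have hJ := eval_eScope g2 k02.
  have hle : eval s2 eDotLe =
      Posz (dot r n d (k %/ d ^ r) a k <= dot r n d (k %/ d ^ r) a i)%R.
    rewrite /eDotLe eval_eGe0 -[in RHS]subr_ge0.
    have hdot := eval_eDot r (hN sm) (hD sm) hJ (a02 : eval s2 (Reg 3) = _).
    rewrite -(hdot _ _ (k02 : eval s2 (Reg 0) = _)).
    by rewrite -(hdot _ _ (q02 : eval s2 (Reg 5) = _)).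
  have h4' : eval s2 (Reg 4 * eNot (Reg 6 * eDotLe))%X = Posz (all (fun q =>
      locally_feasible r n d S (k %/ d ^ r) q ==>
      (dot r n d (k %/ d ^ r) a q < dot r n d (k %/ d ^ r) a k)%R) (iota 0 i.+1)).
    rewrite all_iotaS; apply: eval_eAnd; first by rewrite -h4 -ag2.
    rewrite implybE ltNge -negb_and; apply: eval_eNot; exact: eval_eAnd.
  apply: (wp_assign _ W0 hm0) => //; rewrite h4'; split=> //.
  + by apply: good_set => //; apply: leq_trans (leq_b1 _) W0.
  + split=> //.
    * apply: good_set; last by rewrite (leq_trans id).
      by apply: good_set => //; apply: leq_trans (leq_b1 _) W0.
    * by do 2!apply: agree_set => //; apply: agree_trans ag ag2 _.
    * by rewrite -ho -ho2.
- by move=> s' [g' ag ho h5 h4].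
Qed.

Lemma wp_search s k : good s -> reg s 0 = Posz k ->
  wp search s (fun s' => [/\ good s', agree 1 s s', out s' = out s,
    reg s' 1 = Posz (best r n d S k) & reg s' 2 = Posz (found r n d S k)]).
Proof.
move=> gs k0; case: (hW) => _ _ hMW _ _.
apply: wp_seq; apply: (wp_assign _ W0 hm0) => //.
have g1 : good (set_reg s 1 (eval s 0%X)) by apply: good_set.
apply: wp_seq; apply: (wp_assign _ W0 hm0) => //.
have g2 : good (set_reg (set_reg s 1 (eval s 0%X)) 2 0) by apply: good_set.
set sep := separates r n d S (k %/ d ^ r) k.
pose Inv i s' := [/\ good s', agree 1 s s', out s' = out s, reg s' 3 = Posz i &
  reg s' 1 = Posz (last_sat sep i) /\ reg s' 2 = Posz (has sep (iota 0 i))].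
apply: (@wp_for W W m0 W0 hm0 (cbase r d ^ r) _ _ _ Inv) => //.
- by split=> //; [exact: good_set | do 3!apply: agree_set => //].
- move=> i s' [[sm sr] _ _ h3 _]; split=> //.
  by apply: eval_ePow; apply: eval_eBase; apply: hD.
- move=> i s' iM [g' ag ho h3 [h1 h2]]; apply: wp_seq.
  have k0' : reg s' 0 = Posz k by rewrite ag.
  apply: wp_weaken (wp_check_points g' k0' h3) _ => s2 [g2' ag2 ho2 h4].
  have lt_last j : j <= cbase r d ^ r -> last_sat sep j <= W.
    case: j => [|j] jM //; apply: leq_trans hMW; apply: leq_trans jM.
    by apply: ltnW; apply: last_sat_lt.
  apply: wp_seq; apply: (wp_assign _ W0 hm0) => //.
  have -> : eval s2 (Reg 1 + Reg 4 * (Reg 3 - Reg 1))%X = Posz (last_sat sep i.+1).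
    by rewrite /= h4 !ag2 // h1 h3 -/sep; case: (sep i); rewrite /= ?mul1r ?mul0r; lia.
  have g3 : good (set_reg s2 1 (Posz (last_sat sep i.+1))).
    by apply: good_set => //; apply: lt_last.
  apply: (wp_assign _ W0 hm0) => //; set v := eval _ _.
  have -> : v = Posz (has sep (iota 0 i.+1)).
    by rewrite has_iotaS; apply: eval_eOr; rewrite [LHS]/= ?h4 // ag2.
  have g4 : good (set_reg (set_reg s2 1 (Posz (last_sat sep i.+1))) 2
                 (Posz (has sep (iota 0 i.+1)))).
    by apply: good_set => //; apply: leq_trans (leq_b1 _) W0.
  split=> //.
  + by rewrite -h3 -ag2.
  + split=> //.
    * by apply: good_set => //; rewrite (leq_trans iM).
    * by do 3!apply: agree_set => //; apply: agree_trans ag ag2 _.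
    * by rewrite -ho -ho2.
- by move=> s' [g' ag ho h3 [h1 h2]].
Qed.

Lemma wp_write_row s k : good s -> reg s 0 = Posz k ->
  reg s 1 = Posz (best r n d S k) -> reg s 2 = Posz (found r n d S k) ->
  wp write_row s (fun s' => [/\ good s', agree 3 s s' &
    out s' = out s ++ krow_enc r n d S k]).
Proof.
move=> gs k0 b0 f0; case: (hW) => hnW _ _ _ _.
pose nz j := krow r n d S k j != 0%R.
have hent s' j : good s' -> agree 3 s s' -> reg s' 3 = Posz j ->
    eval s' eEntry = krow r n d S k j.
  move=> g' ag h3; case: (g') => sm _; apply: eval_eCoef; rewrite ?hN ?hD //.
  - by apply: eval_eScope; rewrite ?ag.
  - by rewrite -b0 -ag.
have hnz s' j : good s' -> agree 3 s s' -> reg s' 3 = Posz j ->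
    eval s' eNonzero = Posz (nz j).
  by move=> g' ag h3; apply: eval_eNot; rewrite eval_eEq (hent s' j).
apply: wp_seq; apply: (wp_assign _ W0 hm0) => //.
have g1 : good (set_reg s 4 (eval s 0%X)) by apply: good_set.
apply: wp_seq.
pose Inv i s' := [/\ good s', agree 3 s s', out s' = out s, reg s' 3 = Posz i &
  reg s' 4 = Posz (count nz (iota 0 i))].
apply: (@wp_for W W m0 W0 hm0 (n) _ _ _ Inv) => //.
- by split=> //; [exact: good_set | do 2!apply: agree_set => //].
- by move=> i s' [g' _ _ h3 _]; split=> //; apply: hN; case: g'.
- move=> i s' iN [g' ag ho h3 h4]; apply: (wp_assign _ W0 hm0) => //.
  have cW : count nz (iota 0 i.+1) <= W.
    by rewrite (leq_trans (count_size _ _)) // size_iota (leq_trans iN).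
  have -> : eval s' (Reg 4 + eNonzero)%X = Posz (count nz (iota 0 i.+1)).
    rewrite iota_rcons -cats1 count_cat /= addn0 PoszD -h4.
    by rewrite -(hnz s' i).
  split=> //; first exact: good_set.
  split=> //; first by apply: good_set; [apply: good_set | rewrite (leq_trans iN)].
  by do 2!apply: agree_set => //.
move=> {g1}s1 [g1 ag1 ho1 _ h4]; apply: wp_seq; apply: (wp_write _ W0 hm0) => //.
have ge s' v : good s' -> good (emit s' v) by [].
apply: wp_seq.
pose Inv2 i s' := [/\ good s', agree 3 s s', reg s' 3 = Posz i &
  out s' = out s ++ Posz (count nz (iota 0 n)) ::
    flatten [seq [:: Posz j; krow r n d S k j; 1%R] | j <- iota 0 i & nz j]].
apply: (@wp_for W W m0 W0 hm0 (n) _ _ _ Inv2) => //.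
- split=> //; [by apply: good_set | by apply: agree_set |].
  by rewrite /= h4 ho1 cats1.
- by move=> i s' [g' _ h3 _]; split=> //; apply: hN; case: g'.
- move=> i s' iN [g' ag h3 ho]; apply: (wp_if W0 hm0) => //; rewrite (hnz s' i) //.
  have hW' : i.+1 <= W by rewrite (leq_trans iN).
  have hsplit : [seq [:: Posz j; krow r n d S k j; 1%R] | j <- iota 0 i.+1 & nz j] =
    [seq [:: Posz j; krow r n d S k j; 1%R] | j <- iota 0 i & nz j] ++
    (if nz i then [:: [:: Posz i; krow r n d S k i; 1%R]] else [::]).
    by rewrite iota_rcons filter_rcons; case: (nz i); rewrite ?map_rcons ?cats1 ?cats0.
  case hi: (nz i); rewrite /=; last first.
    apply: wp_skip; split=> //; split=> //; [exact: good_set | exact: agree_set |].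
    by rewrite [out _]/= ho hsplit hi cats0.
  apply: wp_seq; apply: (wp_write _ W0 hm0) => //.
  apply: wp_seq; apply: (wp_write _ W0 hm0); first exact: ge.
  rewrite (hent _ i) //; apply: (wp_write _ W0 hm0); first by [].
  split=> //; split=> //; [exact: good_set | exact: agree_set |].
  by rewrite [out _]/= ho hsplit hi flatten_cat /= h3 -!cats1 -!catA.
move=> s2 [g2 ag2 _ ho2]; apply: wp_seq; apply: (wp_write _ W0 hm0) => //.
apply: (wp_write _ W0 hm0) => //; split=> //=.
case: (g2) => sm _; have k02 : reg s2 0 = Posz k by rewrite ag2.
have b02 : reg s2 1 = Posz (best r n d S k) by rewrite ag2.
have hdot := eval_eDot r (hN sm) (hD sm) (eval_eScope g2 k02)
  (b02 : eval s2 (Reg 1) = _) (k02 : eval s2 (Reg 0) = _).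
have -> : (reg s2 2 * (eval s2 (eDot r eN eD eScope (Reg 1) (Reg 0)) - 1) =
   krhs r n d S k)%R by rewrite hdot ag2 // f0.
by rewrite ho2 -!cats1 -!catA.
Qed.

Lemma wp_kernelize s : good s ->
  wp kernelize s (fun s' => out s' = out s ++ [:: Posz n, Posz d, Posz (knrows r n d) &
    flatten [seq krow_enc r n d S k | k <- iota 0 (knrows r n d)]]).
Proof.
move=> gs; case: (hW) => _ _ _ hKW _; case: (gs) => sm _.
have hR s' : Defs.mem s' = m0 -> eval s' eRows = Posz (knrows r n d).
  by move=> sm'; rewrite /= (eval_ePow r (hN sm')) (eval_ePow r (hD sm')).
apply: wp_seq; apply: (wp_write _ W0 hm0) => //; apply: wp_seq; apply: (wp_write _ W0 hm0) => //.
apply: wp_seq; apply: (wp_write _ W0 hm0) => //.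
pose Inv i s' := [/\ good s', reg s' 0 = Posz i &
  out s' = out s ++ [:: Posz n, Posz d, Posz (knrows r n d) &
    flatten [seq krow_enc r n d S k | k <- iota 0 i]]].
apply: (@wp_for W W m0 W0 hm0 (knrows r n d) _ _ _ Inv) => //.
- split=> //; first by apply: good_set.
  by rewrite hN // hD // hR //= -!cats1 -!catA.
- by move=> i s' [g' h0 _]; split=> //; apply: hR; case: g'.
- move=> i s' iK [g' h0 ho]; apply: wp_seq.
  apply: wp_weaken (wp_search g' h0) _ => s1 [g1 ag1 ho1 h1 h2].
  have h01 : reg s1 0 = Posz i by rewrite ag1.
  apply: wp_weaken (wp_write_row g1 h01 h1 h2) _ => s2 [g2 ag2 ho2].
  split=> //; first by rewrite -h01 -ag2.
  split=> //; first by apply: good_set => //; rewrite (leq_trans iK).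
  rewrite [out _]/= ho2 ho1 ho iota_rcons map_rcons flatten_rcons.
  by rewrite -!catA.
- by move=> s' [].
Qed.

End Program.

(** * Size of the output *)

Lemma enclen_cat w1 w2 : enclen (w1 ++ w2) = enclen w1 + enclen w2.
Proof. by rewrite /enclen big_cat. Qed.

Section SizeBound.

Variables (r n d : nat) (S : seq srow).
Hypotheses (n0 : 0 < n) (d0 : 0 < d).

Lemma enclen_le w b : (forall z, z \in w -> bitlen z <= b) -> enclen w <= size w * b.
Proof.
move=> h; rewrite /enclen -sum1_size big_distrl /= !big_seq leq_sum // => z zw.
by rewrite mul1n h.
Qed.

Lemma abs_cdigit a i : `|cdigit r d a i| <= cbound r d.
Proof.
have h : digit (cbase r d) i a < 2 * cbound r d + 1 := digit_lt i a (cbase_gt0 r d).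
by rewrite /cdigit; lia.
Qed.

Lemma abs_coef J a j : `|coef r n d J a j| <= r * cbound r d.
Proof.
rewrite -[cbound r d]muln1.
apply: (abs_dot_le (a := cdigit r d a) (v := fun i => Posz (digit n i J == j))) => i _.
  exact: abs_cdigit.
exact: leq_b1.
Qed.

Lemma abs_dot J a q : `|dot r n d J a q| <= r * (cbound r d * d).
Proof.
apply: (abs_dot_le (a := cdigit r d a) (v := fun i => Posz (point n d r J q (digit n i J)))) => i _.
  exact: abs_cdigit.
exact/ltnW/point_lt.
Qed.

Lemma coef_supported J a j : coef r n d J a j != 0%R -> in_scope r n J j.
Proof.
apply: contraR => h; rewrite /coef big1 // => i _.
case: eqP => [e|_]; last by rewrite mulr0.
by case/negP: h; rewrite -e in_scope_digit.
Qed.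

(** The nonzero columns lie among the [r] digits of [J], an image of ['I_r]. *)
Lemma card_coef J a : #|[set j : 'I_n | coef r n d J a j != 0%R]| <= r.
Proof.
pose f (i : 'I_r) := Ordinal (digit_lt i J n0).
apply: (@leq_trans #|f @: [set: 'I_r]|); last first.
  by apply: leq_trans (leq_imset_card _ _) _; rewrite cardsT card_ord.
apply/subset_leq_card/subsetP => j; rewrite inE => /coef_supported /hasP[i].
rewrite mem_iota add0n => /= ir /eqP ij; apply/imsetP; exists (Ordinal ir); first by rewrite inE.
exact/ord_inj.
Qed.

Lemma count_iota_ord (P : pred nat) : count P (iota 0 n) = #|[set j : 'I_n | P j]|.
Proof.
rewrite cardsE cardE -val_enum_ord count_map -size_filter {1}enumT.
by congr size; rewrite enumT; apply: eq_filter.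
Qed.

Lemma size_krow_enc k : size (krow_enc r n d S k) <= 3 + 3 * r.
Proof.
rewrite /krow_enc /= size_cat /= size_flatten /shape -map_comp.
have -> : sumn [seq (size \o (fun j => [:: Posz j; krow r n d S k j; 1%R])) j
    | j <- iota 0 n & krow r n d S k j != 0%R] =
    3 * count (fun j => krow r n d S k j != 0%R) (iota 0 n).
  by rewrite -size_filter; elim: [seq _ <- _ | _] => //= j l ->; rewrite mulnS.
have := card_coef (k %/ d ^ r) (best r n d S k).
by rewrite -(count_iota_ord (fun j => krow r n d S k j != 0%R)); lia.
Qed.

End SizeBound.

(** There are [n ^ r * d ^ r] rows of at most [3 + 3 * r] numbers, each of logarithmic length since
    the coefficients are polynomial in [d]. The summand [n + d] is at most the number of rows if
    [r > 0]; for [r = 0] this forces [n] and [d] to be 1. *)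
Lemma kernel_size_bound r : exists C, forall n d S, 0 < n -> 0 < d ->
  (r = 0 -> n = 1 /\ d = 1) ->
  enclen ([:: Posz n, Posz d, Posz (knrows r n d) &
            flatten [seq krow_enc r n d S k | k <- iota 0 (knrows r n d)]]) + (n + d) <=
  C * (n ^ r * d ^ r * (trunc_log 2 (n * d)).+1).
Proof.
have [c [e hB]] := coef_bound_poly r.
pose A := r * c + e + 4.
(* [A * L] is an exponent of 2 bounding all entries, and the 2 accounts for the overhead of
   [bitlen]. The 11 is 3 for each of the three leading numbers and 1 each for [n] and [d]. *)
exists (11 + (3 + 3 * r) * (A + 2)) => n d S n0 d0 hr.
set N := knrows r n d; set L := (trunc_log 2 (n * d)).+1.
have N0 : 0 < N by rewrite muln_gt0 !expn_gt0 n0 d0.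
have ndL : n * d < 2 ^ L by apply: trunc_log_ltn.
have nL : n <= 2 ^ L by apply: leq_trans (ltnW ndL); rewrite leq_pmulr.
have dL : d <= 2 ^ L by apply: leq_trans (ltnW ndL); rewrite leq_pmull.
have [nN dN] : n <= N /\ d <= N.
  rewrite /N /knrows; case: (r) hr => [[] // -> -> //|k _].
  have h x : 0 < x -> x <= x ^ k.+1 by move=> x0; rewrite expnS leq_pmulr // expn_gt0 x0.
  by split; [rewrite -[n]muln1 | rewrite -[d]mul1n];
    apply: leq_mul; rewrite ?h // ?expn_gt0 ?n0 ?d0 // ?muln1 ?mul1n ?h.
have hA z : `|z| <= 2 ^ (A * L) -> bitlen z <= (A + 2) * L.
  by move/bitlen_le => h; apply: leq_trans h _; rewrite mulnDl /L; lia.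
have hbits m : m <= A -> 2 ^ (m * L) <= 2 ^ (A * L).
  by move=> mA; rewrite leq_exp2l // leq_mul2r mA orbT.
have two m : m < 2 ^ (m * L).
  by apply: leq_trans (ltn_expl m (isT : 1 < 2)) _; rewrite leq_exp2l // leq_pmulr.
have dLe : d ^ e <= 2 ^ (e * L).
  by rewrite mulnC expnM; case: (e) => // k; rewrite leq_exp2r.
have rcL : r * c <= 2 ^ (r * c * L) := ltnW (two _).
have hcb : r * cbound r d <= 2 ^ ((r * c + e) * L).
  by rewrite (leq_trans (leq_mul (leqnn r) (hB d))) // mulnA mulnDl expnD leq_mul.
have hdot : r * (cbound r d * d) + 1 <= 2 ^ ((r * c + e + 2) * L).
  have h1 : r * (cbound r d * d) <= 2 ^ ((r * c + e + 1) * L).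
    by rewrite mulnA mulnDl mul1n expnD leq_mul.
  have h2 : 2 * 2 ^ ((r * c + e + 1) * L) <= 2 ^ ((r * c + e + 2) * L).
    by rewrite -expnS leq_exp2l // !mulnDl /L; lia.
  by have := expn_gt0 2 ((r * c + e + 1) * L); lia.
have row_bits k z : z \in krow_enc r n d S k -> bitlen z <= (A + 2) * L.
  have lit m : m <= n -> bitlen (Posz m) <= (A + 2) * L.
    move=> mn; apply: hA; apply: leq_trans mn (leq_trans nL _).
    by rewrite -{1}[L]mul1n hbits // /A; lia.
  have h1 : bitlen 1 <= (A + 2) * L by apply: lit.
  rewrite inE => /orP[/eqP->|].
    by apply: lit; rewrite (leq_trans (count_size _ _)) ?size_iota.
  rewrite mem_cat => /orP[/flatten_mapP[j]|].
    rewrite mem_filter mem_iota add0n => /= /andP[_ jn].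
    rewrite !inE => /or3P[] /eqP-> //; first by apply: lit; apply: ltnW.
    have hcA : 2 ^ ((r * c + e) * L) <= 2 ^ (A * L) by apply: hbits; rewrite /A; lia.
    exact/hA/(leq_trans (abs_coef _ _ _ _ _ _))/(leq_trans hcb).
  rewrite !inE => /orP[] /eqP-> //; apply: hA.
  apply: (@leq_trans (r * (cbound r d * d) + 1)); last first.
    by rewrite (leq_trans hdot) // hbits // /A; lia.
  have : `|dot r n d (k %/ d ^ r) (best r n d S k) k| <= r * (cbound r d * d) by apply: abs_dot.
  rewrite /krhs; move: (dot _ _ _ _ _ _) => y.
  by case: (found _ _ _ _ _); rewrite ?mul1r ?mul0r //; lia.
have bl m : m <= N -> bitlen (Posz m) <= 3 * (N * L).
  move=> mN; apply: (@leq_trans (3 * N)); last by rewrite leq_mul2l leq_pmulr.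
  have h : `|Posz m| <= 2 ^ N := leq_trans mN (ltnW (ltn_expl N (isT : 1 < 2))).
  by apply: leq_trans (bitlen_le h) _; lia.
have rows_bits : enclen (flatten [seq krow_enc r n d S k | k <- iota 0 N]) <=
    (3 + 3 * r) * (A + 2) * (N * L).
  have hl l : enclen (flatten [seq krow_enc r n d S k | k <- l]) <=
      size l * ((3 + 3 * r) * ((A + 2) * L)).
    elim: l => [|k l IH]; first by rewrite /enclen big_nil.
    rewrite map_cons -[flatten _]/(krow_enc r n d S k ++ flatten _) enclen_cat mulSn leq_add //.
    apply: leq_trans (enclen_le (@row_bits k)) _.
    by rewrite leq_mul2r size_krow_enc ?orbT.
  by apply: leq_trans (hl _) _; rewrite size_iota; apply/eq_leq; ring.
have NL : N <= N * L by rewrite leq_pmulr.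
rewrite -/N /enclen !big_cons -/(enclen _).
have := bl _ nN; have := bl _ dN; have := bl _ (leqnn N).
rewrite -/(knrows r n d) -/N; move: rows_bits.
set M := (3 + 3 * r) * (A + 2); rewrite [(11 + M) * _]mulnDl.
move: (N * L) (M * _) (enclen _) NL => x y z NL h1 h2 h3 h4.
lia.
Qed.

(** * Closure properties of polynomial bounds *)

(** A single power suffices because its base is at least 2: constants, sums and products are again
    bounded by such powers. *)
Definition poly_in (X : Type) (sz f : X -> nat) : Prop :=
  exists e, forall x, f x <= (sz x).+2 ^ e.

Section PolyIn.

Variables (X : Type) (sz : X -> nat).
Local Notation poly := (poly_in sz).

Lemma poly_in_le f g : poly g -> (forall x, f x <= g x) -> poly f.
Proof. by move=> [e h] fg; exists e => x; apply: leq_trans (fg x) (h x). Qed.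

Lemma poly_in_size : poly sz.
Proof. by exists 1 => x; rewrite expn1 leqW. Qed.

Lemma poly_in_const c : poly (fun=> c).
Proof.
exists c => x; apply: leq_trans (ltnW (ltn_expl c (isT : 1 < 2))) _.
by case: c => // c; rewrite leq_exp2r.
Qed.

Lemma poly_in_mul f g : poly f -> poly g -> poly (fun x => f x * g x).
Proof. by move=> [a hf] [b hg]; exists (a + b) => x; rewrite expnD leq_mul. Qed.

Lemma poly_in_add f g : poly f -> poly g -> poly (fun x => f x + g x).
Proof.
move=> [a hf] [b hg]; exists (a + b).+1 => x; rewrite expnS expnD.
have := hf x; have := hg x.
have := expn_gt0 (sz x).+2 a; have := expn_gt0 (sz x).+2 b.
by move: (_ ^ a) (_ ^ b) => A B; nia.
Qed.

Lemma poly_in_exp f k : poly f -> poly (fun x => f x ^ k).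
Proof.
move=> hf; elim: k => [|k IH]; first exact: poly_in_const.
by apply: poly_in_le (poly_in_mul hf IH) _ => x; rewrite expnS.
Qed.

Lemma poly_in_com_time W N c : poly W -> poly N -> poly (fun x => com_time (W x) (N x) c).
Proof.
move=> hW hN.
have succ f : poly f -> poly (fun x => (f x).+1).
  move=> hf; apply: poly_in_le (poly_in_add hf (poly_in_const 1)) _ => x.
  by rewrite addn1.
have hexp k : poly (fun x => W x * k) by apply: poly_in_mul hW (poly_in_const k).
elim: c => [|x e|a e|e|c1 h1 c2 h2|e c1 h1 c2 h2|e c h]; rewrite /=.
- exact: poly_in_const.
- exact: succ.
- exact: succ.
- exact: succ.
- exact: poly_in_add.
- by apply/succ/poly_in_add => //; apply: poly_in_add.
- by apply: poly_in_mul; [apply: succ | apply/succ/poly_in_add].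
Qed.

End PolyIn.

Lemma poly_bounded_exp e : poly_bounded (fun k => k.+2 ^ e).
Proof.
(* For positive [k] one has [k.+2 <= 3 * k]; the additive constant covers [k = 0]. *)
exists (3 ^ e + e) => k; case: (posnP k) => [->|k0].
  by rewrite (leq_trans _ (leq_addl _ _)) // (leq_trans _ (leq_addr _ _)) //;
    case: (e) => // i; rewrite leq_exp2r.
apply: leq_trans (leq_addr _ _); apply: (@leq_trans ((3 * k) ^ e)).
  by case: (e) => // i; rewrite leq_exp2r //; lia.
by rewrite expnMn leq_mul ?leq_addr // leq_pexp2l // leq_addl.
Qed.

(** * From instances to systems of rows, and the kernel as an instance *)

Section Instances.

Variable r : nat.

Definition inst_row (n : nat) (a : 'rV[rat]_n) (b : rat) : srow :=
  ([seq (nat_of_ord j, a ord0 j) | j <- enum 'I_n & a ord0 j != 0%R], b).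

Definition inst_rows (I : sbilp r) : seq srow :=
  [seq inst_row (row i (lhs I)) (rhs I i ord0) | i <- enum 'I_(nrows I)].

Lemma enc_rowE n (a : 'rV[rat]_n) b : enc_row a b = enc_srow (inst_row a b).
Proof. by rewrite /enc_row /enc_srow /= size_map -map_comp. Qed.

Lemma enc_sbilpE (I : sbilp r) : enc_sbilp I =
  [:: Posz (nvars I); Posz (dom I); Posz (nrows I)] ++ sys_enc (inst_rows I).
Proof.
rewrite /enc_sbilp /sys_enc /inst_rows -[in RHS]map_comp; congr (_ ++ flatten _).
by apply: eq_map => i; rewrite enc_rowE.
Qed.

Lemma row_val_inst n (a : 'rV[rat]_n) b x :
  row_val x (inst_row a b) = (\sum_(j < n) a ord0 j * (x j)%:R)%R.
Proof.
rewrite /row_val big_map big_filter big_enum_cond /=.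
rewrite [RHS](bigID (fun j => a ord0 j != 0%R)) /= [X in (_ + X)%R]big1 ?addr0 // => j.
by rewrite negbK => /eqP ->; rewrite mul0r.
Qed.

Lemma inst_row_wf (I : sbilp r) c : c \in inst_rows I ->
  size c.1 <= r /\ forall e, e \in c.1 -> e.1 < nvars I.
Proof.
move=> /mapP[i _ ->]; split=> [|e /mapP[j _ ->]]; last exact: ltn_ord.
rewrite size_map size_filter; apply: leq_trans (lhs_sparse i).
rewrite cardsE cardE {1}enumT size_filter; apply/eq_leq/eq_count => j.
by rewrite /= mxE.
Qed.

Lemma sbilp_feasibleE (I : sbilp r) : sbilp_feasible I <->
  exists x : nat -> nat, (forall j, x j < dom I) /\
    forall i, (\sum_(j < nvars I) lhs I i j * (x j)%:R <= rhs I i ord0)%R.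
Proof.
split=> [[x hx]|[x [xd hx]]].
  exists (fun j => if insub j is Some o then x o : nat else 0); split.
    by move=> j; case: insubP => [o _ _|_]; [apply: ltn_ord | apply: dom_gt0].
  move=> i; have := hx i; rewrite mxE; apply: etrans; congr (_ <= _)%R.
  by apply: eq_bigr => j _; rewrite mxE valK.
exists (fun j => Ordinal (xd j)) => i; rewrite mxE.
have := hx i; apply: etrans; congr (_ <= _)%R.
by apply: eq_bigr => j _; rewrite mxE.
Qed.

(* For r = 0 the parameter of the output must be bounded by a constant. *)
Definition kvars (n : nat) : nat := if r is 0 then 1 else maxn 1 n.
Definition kdom (d : nat) : nat := if r is 0 then 1 else d.

Lemma kvars_gt0 n : 0 < kvars n.
Proof. by rewrite /kvars; case: r => // k; rewrite leq_max. Qed.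

Lemma kdom_gt0 d : 0 < d -> 0 < kdom d.
Proof. by rewrite /kdom; case: r. Qed.

Lemma kvars_pos n : 0 < r -> kvars n = maxn 1 n.
Proof. by rewrite /kvars; case: r. Qed.

Lemma kdom_pos d : 0 < r -> kdom d = d.
Proof. by rewrite /kdom; case: r. Qed.

Lemma kvars_eq1 n : r = 0 -> kvars n = 1.
Proof. by rewrite /kvars; case: r. Qed.

Lemma kdom_eq1 d : r = 0 -> kdom d = 1.
Proof. by rewrite /kdom; case: r. Qed.

Lemma kvars_le n : kvars n <= n.+1.
Proof. by rewrite /kvars; case: r => // k; rewrite geq_max ltnS leq0n leqnSn. Qed.

Lemma kdom_le d : 0 < d -> kdom d <= d.
Proof. by rewrite /kdom; case: r. Qed.

(** For [r = 0] all rows are empty and have value 0, so feasibility depends neither on [x] nor on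
    the domain, which may shrink to one value. *)
Lemma feasible_inst_rows (I : sbilp r) : sbilp_feasible I <->
  exists x : nat -> nat, (forall j, x j < kdom (dom I)) /\
    forall c, c \in inst_rows I -> (row_val x c <= c.2)%R.
Proof.
have rowsE x : (forall c, c \in inst_rows I -> (row_val x c <= c.2)%R) <->
    forall i, (\sum_(j < nvars I) lhs I i j * (x j)%:R <= rhs I i ord0)%R.
  split=> [h i|h c /mapP[i _ ->]]; last first.
    by rewrite row_val_inst; under eq_bigr => j _ do rewrite mxE; apply: h.
  have := h (inst_row (row i (lhs I)) (rhs I i ord0)) (map_f _ (mem_enum _ _)).
  by rewrite row_val_inst; under eq_bigr => j _ do rewrite mxE.
rewrite sbilp_feasibleE; case: (posnP r) => [r0|r_gt0]; last first.
  by rewrite kdom_pos //; split=> -[x [xd hx]]; exists x; split=> //; exact/(rowsE x).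
have row0 c x : c \in inst_rows I -> row_val x c = 0%R.
  move=> /inst_row_wf [+ _]; rewrite r0 leqn0 => /nilP h.
  by rewrite /row_val h big_nil.
split=> -[x [xd hx]]; exists (fun=> 0); split.
- by move=> _; apply/kdom_gt0/dom_gt0.
- by move=> c cI; rewrite (row0 _ _ cI) -(row0 c x cI); exact: ((rowsE x).2 hx c cI).
- by move=> _; apply: dom_gt0.
- by apply: ((rowsE (fun=> 0)).1) => c cI; rewrite (row0 _ _ cI) -(row0 c x cI) hx.
Qed.

Section Kernel.

Variable I : sbilp r.

Let n := kvars (nvars I).
Let d := kdom (dom I).
Let S := inst_rows I.

Definition kernel_lhs : 'M[rat]_(knrows r n d, n) := (\matrix_(k, j) (krow r n d S k j)%:~R)%R.
Definition kernel_rhs : 'cV[rat]_(knrows r n d) := (\col_k (krhs r n d S k)%:~R)%R.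

Lemma kernel_sparse : row_sparse r kernel_lhs.
Proof.
move=> k; apply: leq_trans (card_coef r d (kvars_gt0 _) (k %/ d ^ r) (best r n d S k)).
by apply/eq_leq/eq_card => j; rewrite !inE mxE intr_eq0.
Qed.

Definition kernel : sbilp r := SBILP kernel_rhs (kdom_gt0 (dom_gt0 I)) kernel_sparse.

Lemma inst_row_kernel (k : 'I_(knrows r n d)) :
  enc_srow (inst_row (row k kernel_lhs) (kernel_rhs k ord0)) = krow_enc r n d S k.
Proof.
have -> : inst_row (row k kernel_lhs) (kernel_rhs k ord0) =
   ([seq (j, (krow r n d S k j)%:~R%R) | j <- iota 0 n & krow r n d S k j != 0%R],
    (krhs r n d S k)%:~R%R).
  rewrite /inst_row !mxE -val_enum_ord filter_map -map_comp; congr (_, _).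
  under eq_filter => j do rewrite !mxE intr_eq0.
  by apply: eq_map => j; rewrite /= !mxE.
rewrite /enc_srow /krow_enc /enc_rat /= size_map size_filter -map_comp numq_int denq_int.
congr (_ :: flatten _ ++ _); apply: eq_map => j.
by rewrite /= numq_int denq_int.
Qed.

Lemma enc_kernel : enc_sbilp kernel =
  [:: Posz n, Posz d, Posz (knrows r n d) &
      flatten [seq krow_enc r n d S k | k <- iota 0 (knrows r n d)]].
Proof.
rewrite enc_sbilpE /sys_enc /inst_rows -map_comp -val_enum_ord -map_comp.
by congr [:: _, _, _ & flatten _]; apply: eq_map => k; apply: inst_row_kernel.
Qed.

Lemma kernel_feasible : sbilp_feasible kernel <-> sbilp_feasible I.
Proof.
have hS c : c \in S -> size c.1 <= r /\ forall e, e \in c.1 -> e.1 < n.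
  move=> cS; have [sz col] := inst_row_wf cS; split=> // e ec.
  case: (posnP r) => [r0|r_gt0].
    by move: sz; rewrite r0 leqn0 => /nilP h; rewrite h in ec.
  by rewrite /n kvars_pos // leq_max col ?orbT.
rewrite (feasible_inst_rows I) sbilp_feasibleE.
rewrite -(kernel_equiv (kvars_gt0 _) (kdom_gt0 (dom_gt0 I)) hS).
have hrow (x : nat -> nat) (k : 'I_(knrows r n d)) :
    (\sum_(j < n) kernel_lhs k j * (x j)%:R <= kernel_rhs k ord0)%R =
    (\sum_(j < n) krow r n d S k j * Posz (x j) <= krhs r n d S k)%R.
  rewrite -[in RHS](ler_int rat) rmorph_sum mxE; congr (_ <= _)%R.
  by apply: eq_bigr => j _; rewrite mxE /= intrM.
split=> -[x [xd hx]]; exists x; split=> // k.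
  by move=> kN; have := hx (Ordinal kN); rewrite hrow.
by rewrite hrow; apply: hx.
Qed.

End Kernel.

(** The quotient of 1 by [1 + n] is 1 for [n = 0] and 0 otherwise; adding it to [n] gives
    [maxn 1 n]. *)
Definition kvars_expr : expr :=
  if r is 0 then Cst 1
  else Bin Add (Defs.Mem (Cst 0)) (Bin Div (Cst 1) (Bin Add (Cst 1) (Defs.Mem (Cst 0)))).

Definition kdom_expr : expr := if r is 0 then Cst 1 else Defs.Mem (Cst 1).

Lemma eval_kvars_expr s n :
  Defs.mem s 0%R = Posz n -> eval s kvars_expr = Posz (kvars n).
Proof.
rewrite /kvars_expr /kvars; case: r => //= k ->.
by case: n => // n; rewrite divz_small ?addr0 //=; case: n.
Qed.

Lemma eval_kdom_expr s d : Defs.mem s 1%R = Posz d -> eval s kdom_expr = Posz (kdom d).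
Proof. by rewrite /kdom_expr /kdom; case: r. Qed.

(** A sum that dominates every quantity compared with [W] in [wp_kernelize]; the encoding length
    covers both the row addresses and the bit lengths of the input cells. *)
Definition work_bound (I : sbilp r) : nat :=
  let n := kvars (nvars I) in let d := kdom (dom I) in
  enclen (enc_sbilp I) + n + d ^ r + cbase r d ^ r + knrows r n d.

Lemma nth_enclen w k : `|nth 0%R w k| <= 2 ^ enclen w.
Proof.
case: (ltnP k (size w)) => kw; last by rewrite nth_default.
apply: (@leq_trans (2 ^ bitlen (nth 0%R w k))).
  apply: leq_trans (ltnW (trunc_log_ltn _ (isT : 1 < 2))) _.
  by rewrite leq_exp2l // /bitlen.
by rewrite leq_exp2l // /enclen (big_nth 0%R) (bigD1_seq k) ?mem_index_iota ?iota_uniq //= leq_addr.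
Qed.

Lemma size_enclen w : size w <= enclen w.
Proof. by rewrite /enclen -sum1_size leq_sum. Qed.

Lemma kernelize_correct (I : sbilp r) :
  exists2 t, t <= com_time (work_bound I) (work_bound I) (kernelize r kvars_expr kdom_expr) &
    computes_in (kernelize r kvars_expr kdom_expr) (enc_sbilp I) t (enc_sbilp (kernel I)).
Proof.
set w := enc_sbilp I; set W := work_bound I.
pose n := kvars (nvars I); pose d := kdom (dom I); pose S := inst_rows I.
pose m0 := Defs.mem (init w).
have wE : w = [:: Posz (nvars I); Posz (dom I); Posz (nrows I)] ++ sys_enc S by apply: enc_sbilpE.
have sz : size w <= W by rewrite /W /work_bound -!addnA (leq_trans (size_enclen _)) ?leq_addr.
have hm0 a : `|m0 a| <= 2 ^ W.
  case: a => [k|k] //.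
  apply: leq_trans (nth_enclen w k) _; rewrite leq_exp2l //.
  by rewrite /W /work_bound -!addnA leq_addr.
have W0 : 0 < W by apply: leq_trans sz; rewrite wE.
have hN s : Defs.mem s = m0 -> eval s kvars_expr = Posz n.
  by move=> sm; apply: eval_kvars_expr; rewrite sm /m0 wE.
have hD s : Defs.mem s = m0 -> eval s kdom_expr = Posz d.
  by move=> sm; apply: eval_kdom_expr; rewrite sm /m0 wE.
have addr_size : row_addr S (size S) = size w by rewrite /row_addr take_size wE size_cat.
have hrows l t : l < size S -> t < size (enc_srow (nth ([::], 0%R) S l)) ->
    m0 (Posz (row_addr S l + t)) = nth 0%R (enc_srow (nth ([::], 0%R) S l)) t.
  move=> lS tl; rewrite -[m0 _]/(nth 0%R w (row_addr S l + t)) wE nth_cat.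
  rewrite [size [:: _; _; _]]/= /row_addr -addnA ltnNge leq_addr /= addKn.
  have -> : sys_enc S = sys_enc (take l S) ++
      enc_srow (nth ([::], 0%R) S l) ++ sys_enc (drop l.+1 S).
    by rewrite -{1}(cat_take_drop l S) (drop_nth ([::], 0%R)) // /sys_enc map_cat flatten_cat.
  by rewrite nth_cat ltnNge leq_addr /= addKn -cat_cons nth_cat tl.
have good0 : good W m0 (init w).
  by split=> // -[|x] /=.
have [] := @wp_kernelize r kvars_expr kdom_expr n d W S m0 hN hD _ _ _ hrows _ W0 hm0 _ (init w) good0.
- exact: kvars_gt0.
- exact/kdom_gt0/dom_gt0.
- by rewrite -[m0 _]/(nth 0%R w 2) wE /S size_map size_enum_ord.
- by move=> c /inst_row_wf [].
- by rewrite addr_size; split=> //; rewrite /W /work_bound -/n -/d; lia.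
move=> t [s [ex ht ho]]; exists t => //; exists s => //.
by rewrite ho enc_kernel.
Qed.

Definition inst_size (I : sbilp r) : nat := enclen (enc_sbilp I) + (nvars I + dom I).

Lemma poly_work_bound : poly_in inst_size work_bound.
Proof.
have hn : poly_in inst_size (fun I => kvars (nvars I)).
  apply: poly_in_le (poly_in_add (poly_in_const _ 1) (poly_in_size _)) _ => I.
  by rewrite (leq_trans (kvars_le _)) // /inst_size; lia.
have hd : poly_in inst_size (fun I => kdom (dom I)).
  apply: poly_in_le (poly_in_size _) _ => I.
  by rewrite (leq_trans (kdom_le (dom_gt0 I))) // /inst_size; lia.
have hB : poly_in inst_size (fun I => cbase r (kdom (dom I))).
  have [c [e hce]] := coef_bound_poly r; rewrite /cbase /cbound.
  apply: poly_in_add (poly_in_const _ _); apply: poly_in_mul (poly_in_const _ _) _.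
  apply: poly_in_le (poly_in_mul (poly_in_const _ c) (poly_in_exp e hd)) _ => I.
  exact: hce.
rewrite /work_bound /knrows.
do !apply: poly_in_add; try exact: poly_in_exp;
  try exact: poly_in_mul (poly_in_exp _ _) (poly_in_exp _ _).
  by apply: poly_in_le (poly_in_size _) _ => I; rewrite leq_addr.
exact: hn.
Qed.

Lemma kernel_size : exists C, forall I : sbilp r,
  enclen (enc_sbilp (kernel I)) + (nvars (kernel I) + dom (kernel I)) <=
    C * (kvars (nvars I) ^ r * kdom (dom I) ^ r *
         (trunc_log 2 (kvars (nvars I) * kdom (dom I))).+1).
Proof.
have [C hC] := kernel_size_bound r; exists C => I; rewrite enc_kernel.
apply: hC; [exact: kvars_gt0 | exact/kdom_gt0/dom_gt0 |].
by move=> r0; rewrite kvars_eq1 ?kdom_eq1.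
Qed.

End Instances.

Theorem theorem7 (r : nat) :
  exists (c : com) (K : sparse_bounded_ilp r -> sparse_bounded_ilp r),
    poly_kernelization c K /\
    exists C : nat, forall I : sbilp r,
      2 <= nvars I * dom I ->
      isize (K I) <=
        C * (nvars I ^ r * dom I ^ r * trunc_log 2 (nvars I * dom I)).
Proof.
have [C hC] := kernel_size r.
exists (kernelize r (kvars_expr r) (kdom_expr r)), (@kernel r); split; first split.
- have [e he] := poly_in_com_time (kernelize r (kvars_expr r) (kdom_expr r))
    (poly_work_bound r) (poly_work_bound r).
  exists (fun k => k.+2 ^ e); split; first exact: poly_bounded_exp.
  move=> I; have [t ht ct] := kernelize_correct I.
  by exists t => //; apply: leq_trans ht (he I).
- exact: kernel_feasible.
(* For parameter [k], both [kvars] and [kdom] are at most [k.+1], and the logarithm is bounded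
   crudely by its argument. *)
- pose h k := C * (k.+1 ^ r * k.+1 ^ r * (k.+1 * k.+1).+1).
  have [e he] : poly_in id h.
    have hs : poly_in id succn.
      by apply: poly_in_le (poly_in_add (poly_in_const _ 1) (poly_in_size _)) _.
    apply: poly_in_mul (poly_in_const _ _) _.
    apply: poly_in_mul (poly_in_mul _ _) _; try exact: poly_in_exp.
    apply: poly_in_le (poly_in_add (poly_in_const _ 1) (poly_in_mul hs hs)) _ => k.
    by rewrite add1n.
  exists (fun k => k.+2 ^ e); split; first exact: poly_bounded_exp.
  move=> I; apply: leq_trans (hC I) (leq_trans _ (he (pp_param I))).
  set n := kvars _ _; set d := kdom _ _.
  have nk : n <= (nvars I + dom I).+1 by rewrite (leq_trans (kvars_le _ _)) // ltnS leq_addr.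
  have dk : d <= (nvars I + dom I).+1.
    by rewrite (leq_trans (kdom_le _ (dom_gt0 I))) // leqW // leq_addl.
  have powr x y : x <= y -> x ^ r <= y ^ r by case: (r) => // j; rewrite leq_exp2r.
  rewrite /h leq_mul // leq_mul ?ltnS //; first by rewrite leq_mul ?powr.
  apply: leq_trans (leq_mul nk dk).
  have := trunc_logP (isT : 1 < 2) (_ : 0 < n * d).
  rewrite muln_gt0 kvars_gt0 kdom_gt0 ?dom_gt0 // => /(_ isT).
  by apply: leq_trans; apply: ltnW; apply: ltn_expl.
(* Since [nvars I * dom I] is at least 2, its logarithm is at least 1, and the factor 2 absorbs the
   successor in [kernel_size]. *)
exists (2 * C) => I nd2; apply: leq_trans (hC I) _.
have n0 : 0 < nvars I by move: nd2; case: (nvars I).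
have log_gt0 : 0 < trunc_log 2 (nvars I * dom I) by rewrite trunc_log_gt0.
rewrite (mulnC 2) -(mulnA C) leq_mul2l; apply/orP; right.
rewrite mulnCA; case: (posnP r) => [r0|r_gt0].
  by rewrite kvars_eq1 // kdom_eq1 // !exp1n !mul1n !muln_gt0 !expn_gt0 n0 dom_gt0 log_gt0.
rewrite kvars_pos // kdom_pos // (maxn_idPr n0).
by rewrite leq_mul2l; apply/orP; right; lia.
Qed.
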